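(* Let $p$ be a prime greater than $3$ and let $n$ be a positive integer not divisible by $p$. If $n\equiv 1\pmod 3$, then $n$ is a sum of $k$ squares not divisible by $p$ for some positive integer $k\le 4$, except in the case $p=5$ and $n=79$.
   Context: For a prime $p$, an integer $n$ is a sum of $k$ squares not divisible by $p$ if there are integers $x_1,\dots,x_k$ with $n=x_1^2+\cdots+x_k^2$ and $\gcd(p,x_1x_2\cdots x_k)=1$. *)

(* Defs.v *)
From mathcomp Require Import all_boot all_order all_algebra.

Set Implicit Arguments.
Unset Strict Implicit.
Unset Printing Implicit Defensive.

Import GRing.Theory.
Local Open Scope ring_scope.

Definition sum_of_squares_not_divisible (p k : nat) (n : int) : Prop :=
  exists x : 'I_k -> int,
    n = \sum_(i < k) x i ^+ 2 /\ gcdz p%:Z (\prod_(i < k) x i) = 1.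

(* Main.v *)
From Stdlib Require Import ZArith Lia List Znumtheory Zpow_facts Classical.
Require Import Defs.
From mathcomp Require Import all_boot all_order all_algebra.

(* By Lagrange, n = v . v for some integer vector v of length 4. If 3 divides
   u . v, where u has one coordinate 0 and three coordinates 1 or -1, then the
   reflection v - (2/3)(u . v) u is integral again; as n = 1 mod 3, every v admits
   four such moves. It suffices to reach a vector each of whose coordinates is 0
   or prime to p.

   For p > 5, unless n is a square, moves lead to a vector without coordinate
   divisible by 3, and from there at most three more moves suffice; p = 7 needs
   that p does not divide n, since (1, 2, 4, 0) has norm 21.

   For p = 5, suppose that no representation is good. A finite search shows that
   every representation is then, up to signed permutation, proportional modulo 27
   to one of finitely many "nodes", a node being a 3-adic line and a residue
   modulo 5. The moves permute the nodes and lose one power of 3, so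
   proportionality modulo 3^m, for all neighbours at once, lifts to 3^(m+1). Hence v lies on one of the lines, all of
   which are rational, and n = m^2, 46 m^2, 94 m^2 or 79 m^2. The first three are
   visibly good. For n = 79 m^2 with m > 1, a representation which is primitive
   at a prime divisor of m cannot be reached from m (2, 5, 5, 5). *)

Close Scope Z_scope.

(** * Minus one as a sum of two squares modulo a prime *)

(** Pigeonhole: the squares and the values -1 - [b ^ 2] form two families of (p + 1)/2 residues, and
    neither family alone repeats a value. *)
Lemma sum_two_squares_m1_mod (p : nat) : prime p -> odd p ->
  exists a b : nat, [/\ (2 * a < p)%N, (2 * b < p)%N & p %| a ^ 2 + b ^ 2 + 1].
Proof.
move=> p_pr p_odd; have p0 := prime_gt0 p_pr.
pose h := p./2; have ph : p = (2 * h).+1 by rewrite -[LHS]odd_double_half p_odd -mul2n.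
(* Adding [p ^ 2] to -1 - [b ^ 2] keeps the truncated subtraction exact. *)
pose g (x : 'I_h.+1 + 'I_h.+1) : 'I_p := match x with
  | inl a => Ordinal (ltn_pmod (a ^ 2) p0)
  | inr b => Ordinal (ltn_pmod (p ^ 2 - 1 - b ^ 2) p0) end.
have sq (a b : 'I_h.+1) : (a < b)%N -> ~~ (p %| b ^ 2 - a ^ 2).
  move=> ab; rewrite subn_sqr Euclid_dvdM // negb_or.
  have ha := ltn_ord a; have hb := ltn_ord b.
  have b0 : (0 < b)%N by apply: leq_ltn_trans ab.
  apply/andP; split; apply/negP => /dvdn_leq.
    rewrite subn_gt0 ab => /(_ isT); rewrite leqNgt ph ltnS.
    by rewrite (leq_trans (leq_subr _ _)) // (leq_trans (ltnSE hb)) // leq_pmull.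
  rewrite addn_gt0 b0 => /(_ isT).
  by rewrite leqNgt ph ltnS mul2n -addnn leq_add.
have b2 (b : 'I_h.+1) : (b ^ 2 <= p ^ 2 - 1)%N.
  have bp : (b < p)%N by rewrite ph (leq_trans (ltn_ord b)) // ltnS leq_pmull.
  by rewrite -ltnS subn1 prednK ?expn_gt0 ?p0 // ltn_exp2r.
have nosq (a b : 'I_h.+1) : (a ^ 2 == b ^ 2 %[mod p]) -> a = b.
  move=> E; apply/val_inj; case: (ltngtP a b) => // ab.
    have := sq _ _ ab; rewrite -eqn_mod_dvd ?leq_exp2r //; last exact: ltnW.
    by rewrite eq_sym E.
  by have := sq _ _ ab; rewrite -eqn_mod_dvd ?leq_exp2r ?E //; apply: ltnW.
have : ~~ injectiveb g.
  apply/negP => /injectiveP /leq_card.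
  by rewrite card_sum !card_ord addSn addnS addnn -mul2n [X in (_ <= X)%N]ph ltnn.
have hp (a : 'I_h.+1) : (2 * a < p)%N by rewrite ph ltnS leq_mul2l -ltnS ltn_ord.
have mix (a b : 'I_h.+1) : (a ^ 2 = p ^ 2 - 1 - b ^ 2 %[mod p]) ->
    p %| a ^ 2 + b ^ 2 + 1.
  move=> E; rewrite -addnA /dvdn -modnDml E modnDml addnA subnK // subnK ?expn_gt0 ?p0 //.
  by rewrite modnMl.
move=> /injectivePn [x [y]]; case: x y => [a|a] [b|b] ne /(congr1 val) /= E.
- by case/eqP: ne; congr inl; apply: nosq; rewrite E.
- by exists a, b; split => //; apply: mix.
- by exists b, a; split => //; apply: mix.
- case/eqP: ne; congr inr; apply: nosq.
  have : (p ^ 2 - 1 == p ^ 2 - 1 - a ^ 2 + b ^ 2 %[mod p])%N.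
    by rewrite -modnDml E modnDml subnK.
  by rewrite -{1}(subnK (b2 a)) eqn_modDl.
Qed.

Lemma prime_Z (p : nat) : prime p -> Znumtheory.prime (Z.of_nat p).
Proof.
move=> p_pr; apply/prime_alt; split.
  by have /leP := prime_gt1 p_pr; lia.
move=> n n1 [q Eq].
have En : Z.of_nat p = Z.of_nat (Z.to_nat q * Z.to_nat n)%N.
  by rewrite -multE Nat2Z.inj_mul !Z2Nat.id; nia.
have /primeP [_ /(_ (Z.to_nat n))] := p_pr.
rewrite (Nat2Z.inj _ _ En) dvdn_mull // => /(_ isT) /orP [] /eqP; first lia.
by move/(congr1 Z.of_nat); rewrite -En Z2Nat.id; lia.
Qed.

Section IntegerVectors.
Local Open Scope Z_scope.

Ltac mlia := Z.div_mod_to_equations; lia.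

(** * Proportionality modulo M, signed permutations and reflections *)

Inductive vec := V of Z & Z & Z & Z.

(* Every index above 3 also names the last coordinate. *)
Definition co (v : vec) (i : nat) : Z :=
  let: V a b c d := v in
  match i with 0%nat => a | 1%nat => b | 2%nat => c | _ => d end.

Definition dot (v w : vec) : Z :=
  co v 0 * co w 0 + co v 1 * co w 1 + co v 2 * co w 2 + co v 3 * co w 3.

Definition lin (v : vec) (k : Z) (w : vec) : vec :=
  V (co v 0 + k * co w 0) (co v 1 + k * co w 1)
    (co v 2 + k * co w 2) (co v 3 + k * co w 3).

Lemma co_lin v k w i : co (lin v k w) i = co v i + k * co w i.
Proof. by case: v w i => [a b c d] [a' b' c' d'] [|[|[|i]]]. Qed.

(* Proportionality modulo M as the vanishing of the 2 x 2 minors: 0 is proportional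
   to everything, and transitivity needs a middle vector of norm prime to M. *)
Definition par (M : Z) (v r : vec) : Prop :=
  forall i j, Z.divide M (co v i * co r j - co v j * co r i).

(** The square of [co b k] times a minor of a and c is a combination of minors involving b; summing
    over k gives the factor [dot b b], which is cancelled. *)
Lemma par_trans M a b c :
  rel_prime M (dot b b) -> par M a b -> par M b c -> par M a c.
Proof.
move=> cop Hab Hbc i j.
have key k : Z.divide M (co b k * co b k * (co a i * co c j - co a j * co c i)).
  case: (Hab i k) => x1 E1; case: (Hab j k) => x2 E2.
  case: (Hbc k j) => x3 E3; case: (Hbc k i) => x4 E4.
  exists (x1 * co b k * co c j + co a k * co b i * x3
          - x2 * co b k * co c i - co a k * co b j * x4).
  rewrite !(Z.mul_add_distr_r, Z.mul_sub_distr_r).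
  have -> : x1 * co b k * co c j * M = (x1 * M) * co b k * co c j by ring.
  have -> : x2 * co b k * co c i * M = (x2 * M) * co b k * co c i by ring.
  have -> : co a k * co b i * x3 * M = co a k * co b i * (x3 * M) by ring.
  have -> : co a k * co b j * x4 * M = co a k * co b j * (x4 * M) by ring.
  rewrite -E1 -E2 -E3 -E4; ring.
apply: (@Gauss M (dot b b)) => //.
rewrite /dot !Z.mul_add_distr_r.
by do !apply: Z.divide_add_r; apply: key.
Qed.

Lemma par_sym M a b : par M a b -> par M b a.
Proof. by move=> H i j; case: (H j i) => x E; exists x; lia. Qed.

Lemma par_dvd M M' a b : Z.divide M M' -> par M' a b -> par M a b.
Proof. by move=> D H i j; apply: Z.divide_trans (H i j). Qed.

Definition parb (M : Z) (v r : vec) : bool :=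
  let: V a b c d := v in let: V a' b' c' d' := r in
  if (a * b' - b * a') mod M =? 0 then
  if (a * c' - c * a') mod M =? 0 then
  if (a * d' - d * a') mod M =? 0 then
  if (b * c' - c * b') mod M =? 0 then
  if (b * d' - d * b') mod M =? 0 then
  (c * d' - d * c') mod M =? 0
  else false else false else false else false else false.

Ltac pm H :=
  let q := fresh "q" in let E := fresh "E" in
  case: H => /= q E; solve [exists q; lia | exists (- q); lia].

Ltac minor H := solve
  [ exists 0; lia
  | pm (H 0%nat 1%nat) || pm (H 0%nat 2%nat) || pm (H 0%nat 3%nat)
      || pm (H 1%nat 2%nat) || pm (H 1%nat 3%nat) || pm (H 2%nat 3%nat) ].

Lemma par_six M v r :
  (forall i j, (i < j < 4)%N -> Z.divide M (co v i * co r j - co v j * co r i)) ->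
  par M v r.
Proof.
case: v => a b c d; case: r => a' b' c' d' H.
have lt (i j : nat) : (i < j)%N -> Z.divide M
    (co (V a b c d) i * co (V a' b' c' d') j - co (V a b c d) j * co (V a' b' c' d') i).
  case: j => [|[|[|j]]] //; try by move=> ij; apply: H; rewrite ij.
  case: (ltnP i 3) => [i3 _|i3 _]; first by have := H i 3%nat; rewrite i3; apply.
  by case: i i3 => [|[|[|i]]] // _; exists 0; rewrite /=; ring.
move=> i j; case: (ltngtP i j) => [/lt //|/lt [q E]|->]; last by exists 0; ring.
by exists (- q); lia.
Qed.

Lemma parP M v r : 0 < M -> parb M v r <-> par M v r.
Proof.
move=> M0.
have E x : (x mod M =? 0) = true <-> Z.divide M x.
  by rewrite Z.eqb_eq Z.mod_divide //; lia.
case: v => a b c d; case: r => a' b' c' d'; split.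
  rewrite /parb.
  case: ifP => // /E H1; case: ifP => // /E H2; case: ifP => // /E H3.
  case: ifP => // /E H4; case: ifP => // /E H5; move=> /E H6.
  by apply: par_six => -[|[|[|[|i]]]] [|[|[|[|j]]]] /=; rewrite ?andbF.
move=> H; rewrite /parb.
have := H 0%nat 1%nat; have := H 0%nat 2%nat; have := H 0%nat 3%nat.
have := H 1%nat 2%nat; have := H 1%nat 3%nat; have := H 2%nat 3%nat => /=.
by do 6 move=> /E ->.
Qed.

Definition swap v := let: V a b c d := v in V b a c d.
Definition rot3 v := let: V a b c d := v in V b c a d.
Definition rot4 v := let: V a b c d := v in V b c d a.
Definition neg1 v := let: V a b c d := v in V (- a) b c d.

(** Words in generators of the signed permutation group, so that invariance is proved one generator
    at a time; the group being finite, inverses are words too. *)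
Inductive sym : (vec -> vec) -> Prop :=
| sym_id : sym id
| sym_swap f : sym f -> sym (fun v => swap (f v))
| sym_rot3 f : sym f -> sym (fun v => rot3 (f v))
| sym_rot4 f : sym f -> sym (fun v => rot4 (f v))
| sym_neg1 f : sym f -> sym (fun v => neg1 (f v)).

Lemma sym_comp f g : sym f -> sym g -> sym (fun v => f (g v)).
Proof.
move=> Sf Sg; elim: Sf => {f} [|f _ IH|f _ IH|f _ IH|f _ IH] //.
- exact: (sym_swap (fun v => f (g v))).
- exact: (sym_rot3 (fun v => f (g v))).
- exact: (sym_rot4 (fun v => f (g v))).
- exact: (sym_neg1 (fun v => f (g v))).
Qed.

Lemma dot_sym f : sym f -> forall v w, dot (f v) (f w) = dot v w.
Proof.
elim=> {f} // f _ IH v w; rewrite -(IH v w);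
  case: (f v) => a b c d; case: (f w) => a' b' c' d'; rewrite /dot /=; ring.
Qed.

(** Each generator has finite order, so its inverse is a power of it and one direction gives the
    other. *)
Lemma par_symE f : sym f -> forall M v w, par M (f v) (f w) <-> par M v w.
Proof.
have st g h : (forall M v w, par M (h v) (h w) <-> par M v w) ->
   (forall M v w, par M (g v) (g w) <-> par M v w) ->
   (forall M v w, par M (h (g v)) (h (g w)) <-> par M v w).
  by move=> H1 H2 M v w; rewrite H1 H2.
have bij g g' : cancel g g' -> (forall M v w, par M v w -> par M (g v) (g w)) ->
    (forall M v w, par M v w -> par M (g' v) (g' w)) ->
    forall M v w, par M (g v) (g w) <-> par M v w.
  by move=> gK Hg Hg' M v w; split=> [/Hg'|/Hg //]; rewrite !gK.
have Hs M v w : par M v w -> par M (swap v) (swap w).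
  case: v w => [a b c d] [a' b' c' d'] H.
  by apply: par_six => -[|[|[|[|i]]]] [|[|[|[|j]]]] //= _; minor H.
have H3 M v w : par M v w -> par M (rot3 v) (rot3 w).
  case: v w => [a b c d] [a' b' c' d'] H.
  by apply: par_six => -[|[|[|[|i]]]] [|[|[|[|j]]]] //= _; minor H.
have H4 M v w : par M v w -> par M (rot4 v) (rot4 w).
  case: v w => [a b c d] [a' b' c' d'] H.
  by apply: par_six => -[|[|[|[|i]]]] [|[|[|[|j]]]] //= _; minor H.
have Hn M v w : par M v w -> par M (neg1 v) (neg1 w).
  case: v w => [a b c d] [a' b' c' d'] H.
  by apply: par_six => -[|[|[|[|i]]]] [|[|[|[|j]]]] //= _; minor H.
elim=> {f} // f _ IH; apply: (st _) IH.
- by apply: (bij _ swap) => // -[a b c d].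
- apply: (bij _ (fun v => rot3 (rot3 v))) => [[a b c d] //||] //.
  by move=> M v w H; apply/H3/H3.
- apply: (bij _ (fun v => rot4 (rot4 (rot4 v)))) => [[a b c d] //||] //.
  by move=> M v w H; apply/H4/H4/H4.
- by apply: (bij _ neg1) => // -[a b c d] /=; rewrite Z.opp_involutive.
Qed.

(* Unlike has and all, these stop at the first witness under call by value. *)
Fixpoint anyb {T} (p : T -> bool) (s : list T) : bool :=
  if s is x :: s' then if p x then true else anyb p s' else false.

Fixpoint everyb {T} (p : T -> bool) (s : list T) : bool :=
  if s is x :: s' then if p x then everyb p s' else false else true.

Lemma anybP {T} (p : T -> bool) s : anyb p s -> exists2 x, In x s & p x.
Proof.
elim: s => //= x s IH; case: ifP => [px _|_ /IH [y ys py]].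
  by exists x => //; left.
by exists y => //; right.
Qed.

Lemma everybP {T} (p : T -> bool) s x : everyb p s -> In x s -> p x.
Proof. by elim: s => //= y s IH; case: ifP => // py /IH H [<-|/H]. Qed.

Definition grow (g : vec -> vec) (n : nat) (s : list (vec -> vec)) :=
  flat_map (fun f => List.map (fun k v => iter k g (f v)) (iota 0 n)) s.

Definition perms := grow swap 2 (grow rot3 3 (grow rot4 4 (id :: nil))).

(** Each [flip] offers a sign change of the first coordinate and rotates; four of them run through
    all 16 signs and restore the order. *)
Definition syms :=
  let flip := fun s => List.map (fun f v => rot4 (f v)) (grow neg1 2 s) in
  flip (flip (flip (flip perms))).

Lemma grow_sym g n s : (forall f, sym f -> sym (fun v => g (f v))) ->
  (forall f, In f s -> sym f) -> forall f, In f (grow g n s) -> sym f.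
Proof.
move=> Hg Hs f /in_flat_map [f0 [/Hs f0s /in_map_iff [k [<- _]]]].
elim: k => [|k IH] //=; exact: Hg.
Qed.

Lemma syms_sym f : In f syms -> sym f.
Proof.
have fl s : (forall f, In f s -> sym f) ->
    forall f, In f (List.map (fun f v => rot4 (f v)) (grow neg1 2 s)) -> sym f.
  move=> H {}f /in_map_iff [g [<- /(grow_sym _ _ _ sym_neg1 H)]].
  exact: sym_rot4.
do 4 apply: (fl); apply: grow_sym sym_swap _; apply: grow_sym sym_rot3 _.
by apply: grow_sym sym_rot4 _ => g [<-|//]; apply: sym_id.
Qed.

(** Taken up to overall sign, since u and -u give the same reflection: the first nonzero coordinate
    is 1. *)
Definition units : list vec :=
  flat_map (fun y => flat_map (fun z =>
    V 0 1 y z :: V 1 0 y z :: V 1 y 0 z :: V 1 y z 0 :: nil)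
    (1 :: -1 :: nil)) (1 :: -1 :: nil).

Lemma dot_unit u : In u units -> dot u u = 3.
Proof. by rewrite /units /=; intuition; subst. Qed.

(* The reflection in u, provided that 3 divides u . v. *)
Definition move3 (u v : vec) : vec := lin v (- 2 * (dot u v / 3)) u.

Definition modv (M : Z) (v : vec) : vec :=
  let: V a b c d := v in V (a mod M) (b mod M) (c mod M) (d mod M).

(* The same reflection modulo 5, where -2/3 = 1. *)
Definition move5 (u s : vec) : vec := modv 5 (lin s (dot u s) u).

Lemma dot_move3 u v : In u units -> Z.divide 3 (dot u v) ->
  dot (move3 u v) (move3 u v) = dot v v.
Proof.
move=> /dot_unit Hu [q E]; rewrite /move3 E Z.div_mul //.
have -> k : dot (lin v k u) (lin v k u) = dot v v + 2 * k * dot u v + k * k * dot u u.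
  by rewrite /dot !co_lin; ring.
by rewrite Hu E; ring.
Qed.

(** The division by 3 in the reflection costs one power of 3: three times the quantity in [W] is a
    combination of minors of v and r. *)
Lemma par_move3 k u v r : Z.divide 3 (dot u v) -> Z.divide 3 (dot u r) ->
  par (3 * 3 ^ k) v r -> par (3 ^ k) (move3 u v) (move3 u r).
Proof.
move=> [p Ep] [q Eq] H i j; rewrite /move3 Ep Eq !Z.div_mul // !co_lin.
have W l : Z.divide (3 ^ k) (p * co r l - q * co v l).
  case: (H 0%nat l) (H 1%nat l) (H 2%nat l) (H 3%nat l) => [n0 E0] [n1 E1] [n2 E2] [n3 E3].
  exists (co u 0 * n0 + co u 1 * n1 + co u 2 * n2 + co u 3 * n3).
  apply: (Z.mul_reg_l _ _ 3) => //.
  have -> : 3 * (p * co r l - q * co v l) = dot u v * co r l - dot u r * co v l.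
    by rewrite Ep Eq; ring.
  transitivity (co u 0 * (n0 * (3 * 3 ^ k)) + co u 1 * (n1 * (3 * 3 ^ k))
     + co u 2 * (n2 * (3 * 3 ^ k)) + co u 3 * (n3 * (3 * 3 ^ k))); last ring.
  by rewrite -E0 -E1 -E2 -E3 /dot; ring.
case: (W i) (W j) (H i j) => [wi Ei] [wj Ej] [n En].
exists (3 * n + 2 * (co u j * wi - co u i * wj)).
transitivity (n * (3 * 3 ^ k) + 2 * (co u j * (wi * 3 ^ k) - co u i * (wj * 3 ^ k))); last ring.
by rewrite -Ei -Ej -En; ring.
Qed.

Lemma par_refl M v : par M v v.
Proof. by move=> i j; exists 0; ring. Qed.

Lemma par_congr M v v' w w' :
  (forall i, Z.divide M (co v i - co v' i)) ->
  (forall i, Z.divide M (co w i - co w' i)) -> par M v' w' -> par M v w.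
Proof.
move=> Hv Hw H i j.
case: (Hv i) (Hv j) (Hw i) (Hw j) (H i j) => [a Ea] [b Eb] [c Ec] [d Ed] [n En].
exists (a * co w j + co v' i * d - b * co w i - co v' j * c + n).
have -> : co v i = a * M + co v' i by lia.
have -> : co v j = b * M + co v' j by lia.
transitivity (a * M * co w j + co v' i * (co w j - co w' j)
  - b * M * co w i - co v' j * (co w i - co w' i) + n * M); last by rewrite Ec Ed; ring.
by rewrite -En; ring.
Qed.

(** * The 3-adic search for p = 5 *)

Definition nozero5 (s : vec) : bool :=
  everyb (fun i => negb (co s i mod 5 =? 0)) (0 :: 1 :: 2 :: 3 :: nil)%nat.

(* Some walk of at most k moves from a vector proportional to r modulo 3^k and to s
   modulo 5 ends in a vector without coordinate divisible by 5. *)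
Fixpoint reach (k : nat) (r s : vec) : bool :=
  if nozero5 s then true else
  match k with
  | 0%nat => false
  | S k' =>
      if dot r r mod 3 =? 1 then
        anyb (fun u => if dot u r mod 3 =? 0 then reach k' (move3 u r) (move5 u s)
                       else false) units
      else false
  end.

(* Found by computing, for growing k, the vectors modulo 3^k for which reach fails.
   Nodes (r, s) with s <> r belong to no integer vector: r and s are not
   proportional modulo 5. *)
Definition nodes : list (vec * vec) :=
  let e := V 1 0 0 0 in
  (e, e) :: (e, V 0 1 0 0) :: (e, V 1 0 1 2) :: (e, V 0 1 1 2) ::
  (e, V 0 1 1 1) :: (e, V 0 0 1 1) ::
  (V 1 1 1 1, V 0 1 2 3) ::
  List.map (fun r => (r, r))
   (V 1 0 3 6 :: V (-5) 1 4 (-2) ::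
    V 7 0 3 6 :: V (-2) 0 9 3 :: V (-5) 1 (-2) (-8) :: V (-5) 4 7 (-2) ::
    V (-2) (-5) (-5) (-5) :: V (-5) 6 3 3 :: V (-5) 1 7 (-2) :: nil).

Definition on_node (M : Z) (r s : vec) : bool :=
  if dot r r mod 3 =? 1 then if negb (dot s s mod 5 =? 0) then
    anyb (fun f => let r' := f r in let s' := f s in
      anyb (fun n => if parb 5 s' n.2 then parb M r' n.1 else false) nodes) syms
  else false else false.

Definition veqb (v w : vec) :=
  let: V a b c d := v in let: V a' b' c' d' := w in
  if a =? a' then if b =? b' then if c =? c' then d =? d'
  else false else false else false.

(** Equality, not proportionality, in the first component: moves send the chosen integer vectors to
    one another exactly, which lets congruences modulo any power of 3 be carried along. *)
Definition is_node (r s : vec) : bool :=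
  if negb (dot s s mod 5 =? 0) then
    anyb (fun f => let r' := f r in let s' := f s in
      anyb (fun n => if parb 5 s' n.2 then veqb r' n.1 else false) nodes) syms
  else false.

(* The first digit is 0 because vectors are scaled to have first coordinate 1. *)
Definition digits : list vec :=
  flat_map (fun y => flat_map (fun z => List.map (fun t => V 0 y z t) (0 :: 1 :: 2 :: nil))
    (0 :: 1 :: 2 :: nil)) (0 :: 1 :: 2 :: nil).

(** Here r is known modulo [3 ^ k], which supports k moves; an unsettled class is split into 27
    classes modulo the next power. Matching a node waits for k = 3, when r is determined modulo
    27. *)
Fixpoint chk (fuel k : nat) (r s : vec) : bool :=
  if reach k r s then true
  else if (if (3 <= k)%N then on_node 27 r s else false) then true
  else match fuel with
       | 0%nat => false
       | S f => everyb (fun d => chk f k.+1 (lin r (3 ^ Z.of_nat k) d) s) digits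
       end.

Definition vecs (l : list Z) : list vec :=
  flat_map (fun x => flat_map (fun y => flat_map (fun z => List.map (fun t => V x y z t) l)
    l) l) l.

Lemma modv_congr M v i : Z.divide M (co v i - co (modv M v) i).
Proof.
have E x : Z.divide M (x - x mod M).
  case: (Z.eq_dec M 0) => [->|M0]; first by rewrite Zmod_0_r Z.sub_diag; apply: Z.divide_0_r.
  by exists (x / M); rewrite {1}(Z.div_mod x M) //; ring.
by case: v i => a b c d [|[|[|i]]] /=.
Qed.

Lemma par_modv M v : par M v (modv M v).
Proof.
apply: (par_congr _ _ (modv M v) _ (modv M v)); last exact: par_refl.
  exact: modv_congr.
by move=> i; rewrite Z.sub_diag; apply: Z.divide_0_r.
Qed.

Lemma modv_in M l v : (forall x, In (x mod M) l) -> In (modv M v) (vecs l).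
Proof.
move=> H; case: v => a b c d.
apply/in_flat_map; exists (a mod M); split => //.
apply/in_flat_map; exists (b mod M); split => //.
apply/in_flat_map; exists (c mod M); split => //.
by apply/in_map_iff; exists (d mod M).
Qed.

Lemma mod3_in x : In (x mod 3) (0 :: 1 :: 2 :: nil).
Proof. by have := Z.mod_pos_bound x 3 erefl; rewrite /In; lia. Qed.

Lemma mod5_in x : In (x mod 5) (0 :: 1 :: 2 :: 3 :: 4 :: nil).
Proof. by have := Z.mod_pos_bound x 5 erefl; rewrite /In; lia. Qed.

(** Norm 1 modulo 3 means one or four coordinates prime to 3, which leaves two lines up to signs and
    order. *)
Definition start3 : bool :=
  everyb (fun v => if dot v v mod 3 =? 1 then
      anyb (fun f => if parb 3 (f v) (V 1 1 1 1) then true else parb 3 (f v) (V 1 0 0 0))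
        syms
    else true) (vecs (0 :: 1 :: 2 :: nil)).

Lemma start3P : start3.
Proof. by vm_compute. Qed.

(** The symmetries in [st] keep the line of r modulo 3, so the residue modulo 5 can be normalised
    without disturbing the one modulo 3. *)
Definition start5 (r : vec) (l : list vec) : bool :=
  let st := List.filter (fun f => parb 3 (f r) r) syms in
  everyb (fun s =>
    if dot s s mod 5 =? 0 then true else
    if reach 1 r s then true else
    anyb (fun f => anyb (fun s0 => parb 5 (f s) s0) l) st)
   (vecs (0 :: 1 :: 2 :: 3 :: 4 :: nil)).

Definition covered (r : vec) (l : list vec) : bool :=
  if start5 r l then everyb (fun s => chk 4 1 r s) l else false.

(** The second coordinate tells (1, 0, 0, 0) from (1, 1, 1, 1); for each, these are the residues
    modulo 5 left by [start5], up to scaling and symmetry. *)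
Definition seeds (r : vec) : list vec :=
  if co r 1 =? 0 then
    V 1 0 1 2 :: V 1 0 0 0 :: V 0 1 1 2 :: V 0 1 1 1 :: V 0 0 1 1 :: V 0 0 0 1 :: nil
  else V 0 1 2 3 :: V 0 0 0 1 :: nil.

Lemma coveredP : everyb (fun r => covered r (seeds r)) (V 1 1 1 1 :: V 1 0 0 0 :: nil).
Proof. by vm_compute. Qed.

Lemma nodes_closed : everyb (fun n => everyb (fun u =>
  if dot u n.1 mod 3 =? 0 then is_node (move3 u n.1) (move5 u n.2) else true) units) nodes.
Proof. by vm_compute. Qed.

(* Modulo 9 the nodes are already as far apart as modulo 27. *)
Lemma nodes_rigid : everyb (fun f => everyb (fun m => everyb (fun n =>
    if parb 9 (f m.1) n.1 then if parb 5 (f m.2) n.2 then parb 27 (f m.1) n.1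
    else true else true) nodes) nodes) syms.
Proof. by vm_compute. Qed.

Lemma nodes_prim : everyb (fun n =>
    if dot n.1 n.1 mod 3 =? 1 then negb (dot n.2 n.2 mod 5 =? 0) else false) nodes.
Proof. by vm_compute. Qed.

(** * Trapped sets of vectors *)

(** An abstraction of the representations of a counterexample for p = 5; a predicate X leaves room
    for a further property stable under moves. *)
Record trapped (X : vec -> Prop) : Prop := Trapped {
  trap_sym : forall f, sym f -> forall v, X v -> X (f v);
  trap_move : forall u v, In u units -> Z.divide 3 (dot u v) -> X v -> X (move3 u v);
  trap3 : forall v, X v -> dot v v mod 3 = 1;
  trap5 : forall v, X v -> ~ Z.divide 5 (dot v v);
  trap_bad : forall v, X v -> exists i, Z.divide 5 (co v i) }.

Lemma cop3 k x : x mod 3 = 1 -> rel_prime (3 ^ Z.of_nat k) x.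
Proof.
move=> H; apply: rel_prime_sym; apply: rel_prime_Zpower_r; first lia.
apply: rel_prime_sym; apply/prime_rel_prime; first exact: prime_3.
by rewrite -Z.mod_divide // H.
Qed.

Lemma cop5 x : ~ Z.divide 5 x -> rel_prime 5 x.
Proof.
have p5 : Znumtheory.prime 5.
  apply: prime_intro => // n Hn; apply: rel_prime_sym.
  apply/Zgcd_1_rel_prime.
  have : n = 1 \/ n = 2 \/ n = 3 \/ n = 4 by lia.
  by case=> [|[|[|]]] ->.
exact: prime_rel_prime.
Qed.

(** If u . v = 3q, the coefficients -2q of [move3] and 3q of [move5] differ by 5q. *)
Lemma par_move5 u v s : In u units -> Z.divide 3 (dot u v) ->
  par 5 v s -> par 5 (move3 u v) (move5 u s).
Proof.
move=> Hu D H.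
apply: (par_congr _ _ (lin v (dot u v) u) _ (lin s (dot u s) u)).
- move=> i; case: D => q E; exists (- q * co u i).
  by rewrite /move3 !co_lin E Z.div_mul //; ring.
- move=> i; case: (modv_congr 5 (lin s (dot u s) u) i) => q E; exists (- q).
  rewrite Z.mul_opp_l -E /move5 /modv; ring.
move=> i j; rewrite !co_lin.
  have W l : Z.divide 5 (dot u s * co v l - dot u v * co s l).
    case: (H 0%nat l) (H 1%nat l) (H 2%nat l) (H 3%nat l) => [n0 E0] [n1 E1] [n2 E2] [n3 E3].
    exists (- (co u 0 * n0 + co u 1 * n1 + co u 2 * n2 + co u 3 * n3)).
    transitivity (- (co u 0 * (n0 * 5) + co u 1 * (n1 * 5)
       + co u 2 * (n2 * 5) + co u 3 * (n3 * 5))); last ring.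
    by rewrite -E0 -E1 -E2 -E3 /dot; ring.
  case: (W i) (W j) (H i j) => [wi Ei] [wj Ej] [n En].
  exists (n + co u j * wi - co u i * wj).
  transitivity (n * 5 + co u j * (wi * 5) - co u i * (wj * 5)); last ring.
  by rewrite -Ei -Ej -En; ring.
Qed.

Lemma not_dvd5E x : negb (x mod 5 =? 0) = true <-> ~ Z.divide 5 x.
Proof.
rewrite -Z.mod_divide //; case: (Z.eqb_spec (x mod 5) 0) => H; split => //.
Qed.

(** Some coordinate of v is divisible by 5 while that of s is not; by proportionality 5 then divides
    all of v, against [trap5]. *)
Lemma nozero5_escape X v s : trapped X -> X v -> par 5 v s -> nozero5 s -> False.
Proof.
move=> T Xv H Hs; have [i D] := trap_bad _ T v Xv.
apply: (trap5 _ T v Xv).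
have {}D j : Z.divide 5 (co v j).
  have si : ~ Z.divide 5 (co s i).
    have -> : co s i = co s (minn i 3).
      by case: s {H Hs} i {D} => a b c d [|[|[|[|i]]]].
    apply/not_dvd5E; apply: (everybP _ _ _ Hs).
    by have := geq_minr i 3; case: (minn i 3) => [|[|[|[|m]]]] //= _; intuition.
  apply: (Gauss 5 (co s i)); last exact: cop5.
  case: (H i j) D => [q E] [p E']; exists (p * co s j - q).
  by rewrite Z.mul_sub_distr_r -E E'; ring.
by rewrite /dot; do !apply: Z.divide_add_r; apply: Z.divide_mul_l.
Qed.

(** Availability of a move depends only on the line modulo 3, because [dot r r * dot u v] is
    congruent to [dot u r * dot v r]. *)
Lemma dvd3_dot k u v r : dot r r mod 3 = 1 -> par (3 ^ Z.of_nat k.+1) v r ->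
  Z.divide 3 (dot u r) -> Z.divide 3 (dot u v).
Proof.
move=> Hr H [q E].
apply: (Gauss 3 (dot r r)); last by apply: (cop3 1).
have {}H : par 3 v r.
  apply: par_dvd H; exists (3 ^ Z.of_nat k).
  by rewrite Nat2Z.inj_succ Z.pow_succ_r; lia.
have W j : Z.divide 3 (dot u v * co r j - co v j * dot u r).
  case: (H 0%nat j) (H 1%nat j) (H 2%nat j) (H 3%nat j) => [n0 E0] [n1 E1] [n2 E2] [n3 E3].
  exists (co u 0 * n0 + co u 1 * n1 + co u 2 * n2 + co u 3 * n3).
  transitivity (co u 0 * (n0 * 3) + co u 1 * (n1 * 3)
     + co u 2 * (n2 * 3) + co u 3 * (n3 * 3)); last ring.
  by rewrite -E0 -E1 -E2 -E3 /dot; ring.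
case: (W 0%nat) (W 1%nat) (W 2%nat) (W 3%nat) => [n0 E0] [n1 E1] [n2 E2] [n3 E3].
exists (n0 * co r 0 + n1 * co r 1 + n2 * co r 2 + n3 * co r 3 + dot v r * q).
transitivity ((n0 * 3) * co r 0 + (n1 * 3) * co r 1 + (n2 * 3) * co r 2
   + (n3 * 3) * co r 3 + dot v r * (q * 3)); last ring.
by rewrite -E0 -E1 -E2 -E3 -E /dot; ring.
Qed.

Lemma pow3S k : 3 ^ Z.of_nat k.+1 = 3 * 3 ^ Z.of_nat k.
Proof. by rewrite Nat2Z.inj_succ Z.pow_succ_r; lia. Qed.

Lemma reachS k r s : reach k.+1 r s =
  if nozero5 s then true else
  if dot r r mod 3 =? 1 then
    anyb (fun u => if dot u r mod 3 =? 0 then reach k (move3 u r) (move5 u s)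
                   else false) units
  else false.
Proof. by []. Qed.

Lemma reach_escape X k v r s : trapped X -> X v ->
  par (3 ^ Z.of_nat k) v r -> par 5 v s -> reach k r s -> False.
Proof.
move=> T; elim: k v r s => [|k IH] v r s Xv Hr Hs.
  by rewrite /=; case: ifP => // /(nozero5_escape _ _ _ T Xv Hs).
rewrite reachS; case: ifP => [/(nozero5_escape _ _ _ T Xv Hs) //|_].
case: ifP => // /Z.eqb_eq r1 /(anybP _ _) [u Hu].
case: ifP => // /Z.eqb_eq Dr.
have {}Dr : Z.divide 3 (dot u r) by apply/Z.mod_divide.
have Dv := dvd3_dot _ _ _ _ r1 Hr Dr.
apply: (IH (move3 u v)); first exact: (trap_move _ T).
  by apply: par_move3; rewrite -?pow3S.
exact: par_move5.
Qed.

(** As [co r 0 = 1], v is [co v 0] times r up to a multiple of [3 ^ (k + 1)]; the cofactor, divided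
    by the unit [co v 0] modulo 3, gives the next digit. *)
Lemma refine k v r : dot v v mod 3 = 1 -> co r 0 = 1 ->
  par (3 ^ Z.of_nat k.+1) v r ->
  exists2 d, In d digits & par (3 ^ Z.of_nat k.+2) v (lin r (3 ^ Z.of_nat k.+1) d).
Proof.
move=> v1 r0 H.
have vE i : exists z, co v i = co v 0 * co r i + 3 ^ Z.of_nat k.+1 * z.
  by case: (H i 0%nat) => z; rewrite r0 => E; exists z; lia.
have x1 : (co v 0 * co v 0) mod 3 = 1.
  have [z3 E] : Z.divide 3 (3 ^ Z.of_nat k.+1) by exists (3 ^ Z.of_nat k); rewrite pow3S; lia.
  case: (vE 1%nat) (vE 2%nat) (vE 3%nat) => [a Ea] [b Eb] [c Ec].
  have := mod3_in (co v 0); rewrite /= -!/(co v 0).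
  have := Z.div_mod (co v 0) 3; move: (co v 0 / 3) => y Ey [E0|[E0|[E0|//]]].
  - move: v1; rewrite /dot Ea Eb Ec E.
    have -> : co v 0 = 3 * y by lia.
    match goal with |- ?G mod 3 = 1 -> _ => suff -> : G = 3 * (y * co v 0
      + 3 * ((y * co r 1 + z3 * a) ^ 2 + (y * co r 2 + z3 * b) ^ 2
      + (y * co r 3 + z3 * c) ^ 2)) end.
      by rewrite Z.mul_comm Z.mod_mul.
    by rewrite (_ : co v 0 = 3 * y); [ring | lia].
  - have -> : co v 0 = 3 * y + 1 by lia.
    have -> : (3 * y + 1) * (3 * y + 1) = 1 + (3 * y * y + 2 * y) * 3 by ring.
    by rewrite Z.mod_add.
  - have -> : co v 0 = 3 * y + 2 by lia.
    have -> : (3 * y + 2) * (3 * y + 2) = 1 + (3 * y * y + 4 * y + 1) * 3 by ring.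
    by rewrite Z.mod_add.
case: (vE 1%nat) (vE 2%nat) (vE 3%nat) => [a Ea] [b Eb] [c Ec].
(* Modulo 3 the unit [co v 0] is its own inverse, so this is division by it. *)
pose D z := (co v 0 * z) mod 3.
have DE z : exists q, z = co v 0 * D z + 3 * q.
  have E1 := Z.div_mod (co v 0 * co v 0) 3; have E2 := Z.div_mod (co v 0 * z) 3.
  exists (co v 0 * (co v 0 * z / 3) - (co v 0 * co v 0) / 3 * z).
  have -> : co v 0 * D z = co v 0 * (co v 0 * z - 3 * (co v 0 * z / 3)) by rewrite /D; lia.
  move: E1; rewrite x1 => E1.
  transitivity ((co v 0 * co v 0) * z - 3 * (co v 0 * co v 0 / 3) * z); last ring.
  by rewrite {1}E1; [ring | lia].
exists (V 0 (D a) (D b) (D c)).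
  apply/in_flat_map; exists (D a); split; first exact: mod3_in.
  apply/in_flat_map; exists (D b); split; first exact: mod3_in.
  apply/in_map_iff; exists (D c); split; [by [] | exact: mod3_in].
have K i : exists q, co v i =
    co v 0 * co (lin r (3 ^ Z.of_nat k.+1) (V 0 (D a) (D b) (D c))) i + q * 3 ^ Z.of_nat k.+2.
  have K3 z w j : co v j = co v 0 * co r j + 3 ^ Z.of_nat k.+1 * z ->
      w = D z -> exists q, co v j = co v 0 * (co r j + 3 ^ Z.of_nat k.+1 * w) + q * 3 ^ Z.of_nat k.+2.
    move=> -> ->; case: (DE z) => q Eq; exists q; rewrite (pow3S k.+1).
    move: (3 ^ Z.of_nat k.+1) => P.
    transitivity (co v 0 * co r j + P * (co v 0 * D z + 3 * q)); last ring.
    by rewrite -Eq.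
  rewrite co_lin; case: i => [|[|[|i]]].
  - by exists 0; rewrite r0 [co _ 0]/= Z.mul_0_r Z.mul_1_r Z.add_0_r.
  - exact: K3 Ea _.
  - exact: K3 Eb _.
  - have cE w : co w i.+3 = co w 3 by case: w.
    by rewrite !cE; apply: K3 Ec _.
move=> i j; case: (K i) (K j) => [p Ep] [q Eq].
set r' := lin _ _ _ in Ep Eq *.
exists (p * co r' j - q * co r' i).
by rewrite {1}Ep {1}Eq; ring.
Qed.

Lemma on_nodeP M v r s : 0 < M -> rel_prime M (dot r r) ->
  par M v r -> par 5 v s -> on_node M r s ->
  exists f n, [/\ sym f, In n nodes, par M (f v) n.1 & par 5 (f v) n.2].
Proof.
move=> M0 copM Hr Hs; rewrite /on_node; case: ifP => // _.
case: ifP => // /not_dvd5E s5 /(anybP _ _) [f /syms_sym Sf] /(anybP _ _) [n Hn].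
case: ifP => // /(parP 5 _ _ erefl) H5 /(parP _ _ _ M0) HM.
exists f, n; split => //.
  by apply: par_trans HM; [rewrite (dot_sym _ Sf) | apply/par_symE].
by apply: par_trans H5; [rewrite (dot_sym _ Sf); apply: cop5 | apply/par_symE].
Qed.

Lemma dot_lin3 r k d : dot r r mod 3 = 1 -> dot (lin r (3 * k) d) (lin r (3 * k) d) mod 3 = 1.
Proof.
move=> <-; rewrite -(Z.mod_add (dot r r) (2 * k * dot r d + 3 * k * k * dot d d)) //.
by congr (_ mod _); rewrite /dot !co_lin; ring.
Qed.

Lemma dvd_pow3 m k : (m <= k)%N -> Z.divide (3 ^ Z.of_nat m) (3 ^ Z.of_nat k).
Proof.
move=> /leP mk; exists (3 ^ Z.of_nat (k - m)); rewrite -Z.pow_add_r; try lia.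
by congr (_ ^ _); rewrite -minusE; lia.
Qed.

Lemma chk_node X fuel k v r s : trapped X -> X v -> co r 0 = 1 -> dot r r mod 3 = 1 ->
  par (3 ^ Z.of_nat k.+1) v r -> par 5 v s -> chk fuel k.+1 r s ->
  exists f n, [/\ sym f, In n nodes, par 27 (f v) n.1 & par 5 (f v) n.2].
Proof.
move=> T Xv; elim: fuel k r => [|fuel IH] k r r0 r1 Hr Hs.
  rewrite /chk; case: ifP => [/(reach_escape _ _ _ _ _ T Xv Hr Hs) //|_].
  case: ifP => // + _; case: ifP => // k3; apply: on_nodeP => //; first exact: (cop3 3).
  by apply: par_dvd Hr; apply: (dvd_pow3 3).
have -> : chk fuel.+1 k.+1 r s =
  if reach k.+1 r s then true
  else if (if (3 <= k.+1)%N then on_node 27 r s else false) then true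
  else everyb (fun d => chk fuel k.+2 (lin r (3 ^ Z.of_nat k.+1) d) s) digits by [].
case: ifP => [/(reach_escape _ _ _ _ _ T Xv Hr Hs) //|_].
case: ifP => [+ _|_].
  case: ifP => // k3; apply: on_nodeP => //; first exact: (cop3 3).
  by apply: par_dvd Hr; apply: (dvd_pow3 3).
have [d Hd Hpar] := refine _ _ _ (trap3 _ T _ Xv) r0 Hr.
move=> /(everybP _ _ _ ) /(_ Hd); apply: IH => //.
  rewrite co_lin r0; suff -> : co d 0 = 0 by lia.
  move: Hd => /in_flat_map [y [_ /in_flat_map [z [_ /in_map_iff [t [<- _]]]]]] //.
by rewrite pow3S; apply: dot_lin3.
Qed.

Lemma dot_modv M v : Z.divide M (dot v v - dot (modv M v) (modv M v)).
Proof.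
set w := modv M v.
have -> : dot v v - dot w w = (co v 0 - co w 0) * (co v 0 + co w 0)
  + (co v 1 - co w 1) * (co v 1 + co w 1) + (co v 2 - co w 2) * (co v 2 + co w 2)
  + (co v 3 - co w 3) * (co v 3 + co w 3) by rewrite /dot; ring.
by do !apply: Z.divide_add_r; apply: Z.divide_mul_l; apply: modv_congr.
Qed.

(** A symmetry f normalises v modulo 3, then g, which keeps the line modulo 3, brings it to a seed
    modulo 5; the search supplies h and the node. *)
Lemma start_node X v : trapped X -> X v ->
  exists f n, [/\ sym f, In n nodes, par 27 (f v) n.1 & par 5 (f v) n.2].
Proof.
move=> T Xv.
have [f [r [Sf rin Hr]]] : exists f r,
    [/\ sym f, In r (V 1 1 1 1 :: V 1 0 0 0 :: nil) & par 3 (f v) r].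
  have := everybP _ _ _ start3P (modv_in 3 _ v mod3_in).
  have w1 : dot (modv 3 v) (modv 3 v) mod 3 = 1.
    case: (dot_modv 3 v) => q E; rewrite -(Z.mod_add _ q) // -E -(trap3 _ T _ Xv).
    by congr (_ mod _); ring.
  case: ifP => [_|/Z.eqb_neq //] /(anybP _ _) [f /syms_sym Sf].
  have Hv r : par 3 (f (modv 3 v)) r -> par 3 (f v) r.
    apply: par_trans; first by rewrite (dot_sym _ Sf); apply: (cop3 1).
    by apply/par_symE => //; apply: par_modv.
  case: ifP => [/(parP 3 _ _ erefl) /Hv H _|_ /(parP 3 _ _ erefl) /Hv H].
    by exists f, (V 1 1 1 1); split => //; left.
  by exists f, (V 1 0 0 0); split => //; right; left.
have [r0 r1] : co r 0 = 1 /\ dot r r mod 3 = 1 by case: rin => [<-|[<-|//]].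
have Xf := trap_sym _ T _ Sf _ Xv.
have := everybP _ _ _ coveredP rin; rewrite /covered; case: ifP => // Hst Hchk.
have := everybP _ _ _ Hst (modv_in 5 _ (f v) mod5_in).
have s5 : ~ Z.divide 5 (dot (modv 5 (f v)) (modv 5 (f v))).
  case: (dot_modv 5 (f v)) => q E [p E']; apply: (trap5 _ T _ Xf).
  by exists (q + p); lia.
have Hs := par_modv 5 (f v).
case: ifP => [/Z.eqb_eq /Z.mod_divide H|_]; first by case: s5; apply: H.
case: ifP => [/(reach_escape _ _ _ _ _ T Xf) H|_]; first by case: (H Hr Hs).
move=> /(anybP _ _) [g /filter_In [/syms_sym Sg /(parP 3 _ _ erefl) Hg]].
move=> /(anybP _ _) [s0 s0in /(parP 5 _ _ erefl) Hs0].
have [|||h [n [Sh nin Hn1 Hn2]]] := chk_node X 4 0 (g (f v)) r s0 T _ r0 r1 _ _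
  (everybP _ _ _ Hchk s0in).
- exact: (trap_sym _ T).
- have -> : 3 ^ Z.of_nat 1 = 3 by [].
  apply: par_trans Hg; first by rewrite (dot_sym _ Sg); apply: (cop3 1).
  exact/par_symE.
- apply: par_trans Hs0; first by rewrite (dot_sym _ Sg); apply: cop5.
  exact/par_symE.
exists (fun v => h (g (f v))), n; split => //.
exact: (sym_comp _ _ Sh (sym_comp _ _ Sg Sf)).
Qed.

(** * Lifting to all powers of 3 *)

Lemma pow3_neq0 k : 3 ^ Z.of_nat k <> 0.
Proof. by apply: Z.pow_nonzero; lia. Qed.

Lemma veqbP v w : veqb v w -> v = w.
Proof.
case: v w => [a b c d] [a' b' c' d'] /=.
by do 3 (case: Z.eqb_spec => // ->); move=> /Z.eqb_eq ->.
Qed.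

(* A signed permutation f is determined by f (1, 2, 3, 4). *)
Definition act (w v : vec) : vec :=
  let pick a := Z.sgn a * co v (Z.to_nat (Z.abs a - 1)) in
  let: V a b c d := w in V (pick a) (pick b) (pick c) (pick d).

Lemma actE f : sym f -> forall v, f v = act (f (V 1 2 3 4)) v.
Proof.
elim=> {f} [|f _ IH|f _ IH|f _ IH|f _ IH] v; last 1 first.
- rewrite IH; case: (f (V 1 2 3 4)) => a b c d /=.
  by rewrite Z.sgn_opp Z.abs_opp Z.mul_opp_l.
- transitivity (V (1 * co v 0) (1 * co v 1) (1 * co v 2) (1 * co v 3)) => //.
  by case: v => a b c d; rewrite !Z.mul_1_l.
all: by rewrite IH; case: (f (V 1 2 3 4)).
Qed.

Lemma syms_closed : let W := List.map (fun f => f (V 1 2 3 4)) syms in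
  everyb (fun w => everyb (fun g => anyb (veqb (g w)) W) (swap :: rot3 :: rot4 :: neg1 :: nil)) W.
Proof. by vm_compute. Qed.

(** The images of (1, 2, 3, 4) under [syms] are closed under the generators, and such an image
    determines the signed permutation. *)
Lemma syms_complete f : sym f -> exists2 g, In g syms & f =1 g.
Proof.
move=> Sf; set W := List.map (fun f => f (V 1 2 3 4)) syms.
have : In (f (V 1 2 3 4)) W.
  have st g h : In (h (V 1 2 3 4)) W -> In g (swap :: rot3 :: rot4 :: neg1 :: nil) ->
      In (g (h (V 1 2 3 4))) W.
    move=> Hh Hg; have := everybP _ _ _ (everybP _ _ _ syms_closed Hh) Hg.
    by move=> /(anybP _ _) [w Hw /veqbP ->].
  elim: Sf => {f} [|f _ IH|f _ IH|f _ IH|f _ IH]; last first.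
  - by apply: (st neg1) => //; do 3 right; left.
  - by apply: (st rot4) => //; do 2 right; left.
  - by apply: (st rot3) => //; right; left.
  - by apply: (st swap) => //; left.
  have : anyb (veqb (V 1 2 3 4)) W by vm_compute.
  by move=> /(anybP _ _) [w Hw /veqbP ->].
move=> /in_map_iff [g [E gin]]; exists g => // v.
by rewrite (actE _ Sf) -E -(actE _ (syms_sym _ gin)).
Qed.

Lemma unitP u : anyb (veqb u) units -> In u units.
Proof.
by move=> /(anybP _ _) [w Hw /veqbP ->].
Qed.

(* A move divides the minors of (v, r) by 3 unless they satisfy a linear congruence
   modulo 3; the four congruences together force one more factor 3. *)
Lemma lift_par k v r : par 3 r (V 1 1 1 1) \/ par 3 r (V 1 0 0 0) ->
  dot r r mod 3 = 1 -> par (3 ^ Z.of_nat k.+1) v r ->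
  (forall u, In u units -> Z.divide 3 (dot u r) ->
     par (3 ^ Z.of_nat k.+1) (move3 u v) (move3 u r)) ->
  par (3 ^ Z.of_nat k.+2) v r.
Proof.
move=> Hr r1 H Hm.
have div3 x : Z.divide 3 x <-> x mod 3 = 0 by rewrite Z.mod_divide.
(* [N] is the matrix of minors divided by [3 ^ (k + 1)]; its entries must be shown divisible by
   3. *)
have [N HN] : exists N : nat -> nat -> Z, forall i j,
    co v i * co r j - co v j * co r i = 3 ^ Z.of_nat k.+1 * N i j.
  exists (fun i j => (co v i * co r j - co v j * co r i) / 3 ^ Z.of_nat k.+1) => i j.
  have P := pow3_neq0 k.+1.
  by case: (H i j) => q ->; rewrite Z.div_mul //; ring.
(* The move fixes coordinate c, so it changes the minor (i, c) by [2 * co u i * 3 ^ k] times this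
   sum, up to sign; old and new minors are divisible by [3 ^ (k + 1)]. *)
have dotN u c : In u units -> co u c = 0 -> Z.divide 3 (dot u r) ->
    Z.divide 3 (co u 0 * N 0%nat c + co u 1 * N 1%nat c + co u 2 * N 2%nat c + co u 3 * N 3%nat c).
  move=> Hu uc Dr; have Dv := dvd3_dot _ _ _ _ r1 H Dr.
  set S := (X in Z.divide 3 X).
  have [i Hi] : exists i, co u i * co u i = 1.
    by move: Hu; rewrite /units /=; intuition; subst; (by exists 0%nat) || (by exists 1%nat).
  have := Hm u Hu Dr i c; case: (Dv) (Dr) => [p Ep] [q Eq].
  rewrite /move3 Ep Eq !Z.div_mul // !co_lin uc.
  have ES : p * co r c - q * co v c = 3 ^ Z.of_nat k * S.
    apply: (Z.mul_reg_l _ _ 3) => //.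
    transitivity (dot u v * co r c - dot u r * co v c); first by rewrite Ep Eq; ring.
    transitivity (co u 0 * (3 ^ Z.of_nat k.+1 * N 0%nat c) + co u 1 * (3 ^ Z.of_nat k.+1 * N 1%nat c)
      + co u 2 * (3 ^ Z.of_nat k.+1 * N 2%nat c) + co u 3 * (3 ^ Z.of_nat k.+1 * N 3%nat c)).
      by rewrite -!HN /dot; ring.
    by rewrite pow3S /S; move: (3 ^ Z.of_nat k) => P; ring.
  case=> t Et; exists (S - co u i * (N i c - t)).
  suff E : 2 * (co u i * S) = 3 * (N i c - t).
    transitivity (3 * S - 2 * (co u i * co u i * S)); first by rewrite Hi; ring.
    transitivity (3 * S - co u i * (2 * (co u i * S))); first by ring.
    by rewrite E; ring.
  apply: (Z.mul_reg_l _ _ _ (pow3_neq0 k)).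
  transitivity (2 * co u i * (p * co r c - q * co v c)); first by rewrite ES; ring.
  move: Et; rewrite pow3S => Et.
  transitivity (3 * 3 ^ Z.of_nat k * N i c - t * (3 * 3 ^ Z.of_nat k)); last by ring.
  by rewrite -Et -pow3S -HN; ring.
(* The wedge product of r with the bivector of minors of v and r vanishes. *)
have plucker i j l : N i j * co r l + N j l * co r i + N l i * co r j = 0.
  apply: (Z.mul_reg_l _ _ _ (pow3_neq0 k.+1)).
  transitivity (3 ^ Z.of_nat k.+1 * N i j * co r l + 3 ^ Z.of_nat k.+1 * N j l * co r i
    + 3 ^ Z.of_nat k.+1 * N l i * co r j); first by ring.
  by rewrite -!HN; ring.
have anti i j : N i j = - N j i.
  apply: (Z.mul_reg_l _ _ _ (pow3_neq0 k.+1)).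
  by rewrite Z.mul_opp_r -!HN; ring.
suff D : forall i j, (i < j < 4)%N -> Z.divide 3 (N i j).
  by apply: par_six => i j /D [q E]; rewrite HN (pow3S k.+1) E; exists q; ring.
have r0 : co r 0 mod 3 = 1 \/ co r 0 mod 3 = 2.
  have [e e0 He] : exists2 e, co e 0 = 1 & par 3 r e.
    by case: Hr => Hr; [exists (V 1 1 1 1) | exists (V 1 0 0 0)].
  case: (mod3_in (co r 0)) => [E|[<-|[<-|//]]]; [|by left|by right].
  have D0 : Z.divide 3 (co r 0) by apply/div3.
  have D i : Z.divide 3 (co r i).
    case: D0 (He i 0%nat) => p Ep [q]; rewrite e0 Ep => Eq.
    by exists (q + p * co e i); lia.
  suff : Z.divide 3 (dot r r) by move/div3; rewrite r1.
  by rewrite /dot; do !apply: Z.divide_add_r; apply: Z.divide_mul_l.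
have G x : Z.divide 3 (co r 0 * x) -> Z.divide 3 x.
  move=> Dx; apply: (Gauss 3 _ _ Dx); apply/prime_rel_prime; first exact: prime_3.
  by rewrite -Z.mod_divide //; lia.
case: Hr => Hr.
  have rE i : Z.divide 3 (co r 0 - co r i).
    case: (Hr 0%nat i) => q; case: i => [|[|[|i]]] /= E; exists q; lia.
  have tri i j l : Z.divide 3 (N i j + N j l + N l i).
    apply: G; case: (rE i) (rE j) (rE l) => [a Ea] [b Eb] [c Ec].
    exists (c * N i j + a * N j l + b * N l i).
    have := plucker i j l.
    rewrite (_ : co r i = co r 0 - a * 3); last lia.
    rewrite (_ : co r j = co r 0 - b * 3); last lia.
    rewrite (_ : co r l = co r 0 - c * 3); last lia.
    lia.
  have ur u : co u 0 + co u 1 + co u 2 + co u 3 = 3 -> Z.divide 3 (dot u r).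
    move=> Eu; case: (rE 1%nat) (rE 2%nat) (rE 3%nat) => [a Ea] [b Eb] [c Ec].
    exists (co r 0 - co u 1 * a - co u 2 * b - co u 3 * c); rewrite /dot.
    rewrite (_ : co r 1 = co r 0 - a * 3); last lia.
    rewrite (_ : co r 2 = co r 0 - b * 3); last lia.
    rewrite (_ : co r 3 = co r 0 - c * 3); last lia.
    rewrite (_ : co u 0 = 3 - co u 1 - co u 2 - co u 3); last lia.
    ring.
  have := dotN (V 0 1 1 1) 0%nat (unitP (V 0 1 1 1) erefl) erefl (ur (V 0 1 1 1) erefl).
  have := dotN (V 1 0 1 1) 1%nat (unitP (V 1 0 1 1) erefl) erefl (ur (V 1 0 1 1) erefl).
  have := dotN (V 1 1 0 1) 2%nat (unitP (V 1 1 0 1) erefl) erefl (ur (V 1 1 0 1) erefl).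
  have := dotN (V 1 1 1 0) 3%nat (unitP (V 1 1 1 0) erefl) erefl (ur (V 1 1 1 0) erefl).
  cbn [co]; rewrite (anti 1%nat 0%nat) (anti 2%nat 0%nat) (anti 3%nat 0%nat).
  rewrite (anti 2%nat 1%nat) (anti 3%nat 1%nat) (anti 3%nat 2%nat).
  have z i : N i i = 0 by have := anti i i; lia.
  rewrite !z => -[s1 E1] [s2 E2] [s3 E3] [s4 E4].
  (* Modulo 3, [N i j] is [N 0 j - N 0 i]. The sum for c = 0 makes the three [N 0 j] add up to 0,
     the one for c = 1 kills [N 0 2 + N 0 3], hence [N 0 1]; the others are similar. *)
  case: (tri 0%nat 1%nat 2%nat) (tri 0%nat 1%nat 3%nat) (tri 0%nat 2%nat 3%nat).
  rewrite (anti 2%nat 0%nat) (anti 3%nat 0%nat) => t3 F3 [t2 F2] [t1 F1].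
  have D1 : Z.divide 3 (N 0%nat 1%nat) by exists (s3 + t3 + t2 - s4 - N 0%nat 1%nat); lia.
  have D2 : Z.divide 3 (N 0%nat 2%nat) by exists (s2 + t1 - t3 - s4 - N 0%nat 2%nat); lia.
  have D3 : Z.divide 3 (N 0%nat 3%nat) by exists (s1 - t1 - t2 - s4 - N 0%nat 3%nat); lia.
  case: (D1) (D2) (D3) => [d1 G1] [d2 G2] [d3 G3].
  have D4 : Z.divide 3 (N 1%nat 2%nat) by exists (t3 - d1 + d2); lia.
  have D5 : Z.divide 3 (N 1%nat 3%nat) by exists (t2 - d1 + d3); lia.
  have D6 : Z.divide 3 (N 2%nat 3%nat) by exists (t1 - d2 + d3); lia.
  by move=> -[|[|[|[|i]]]] [|[|[|[|j]]]] /=; rewrite ?andbF.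
have rE i : Z.divide 3 (co r i.+1).
  by case: (Hr i.+1 0%nat) => q; case: i => [|[|i]] /= E; exists q; lia.
have ur u : co u 0 = 0 -> Z.divide 3 (dot u r).
  move=> u0; rewrite /dot u0 Z.mul_0_l.
  by do !apply: Z.divide_add_r; first exact: Z.divide_0_r; apply: Z.divide_mul_r.
(* Adding or subtracting two of these three sums isolates one [N j 0]. *)
have := dotN (V 0 1 1 1) 0%nat (unitP (V 0 1 1 1) erefl) erefl (ur (V 0 1 1 1) erefl).
have := dotN (V 0 1 1 (-1)) 0%nat (unitP (V 0 1 1 (-1)) erefl) erefl (ur (V 0 1 1 (-1)) erefl).
have := dotN (V 0 1 (-1) 1) 0%nat (unitP (V 0 1 (-1) 1) erefl) erefl (ur (V 0 1 (-1) 1) erefl).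
have z0 : N 0%nat 0%nat = 0 by have := anti 0%nat 0%nat; lia.
cbn [co] => -[s1 E1] [s2 E2] [s3 E3].
have z i : (i < 3)%N -> Z.divide 3 (N i.+1 0%nat).
  case: i => [|[|[|i]]] // _.
  - by exists (N 1%nat 0%nat - s1 - s2); lia.
  - by exists (N 2%nat 0%nat - s3 + s1); lia.
  - by exists (N 3%nat 0%nat - s3 + s2); lia.
move=> [|i] [|j] //.
  by move=> /= j3; rewrite anti; apply/Z.divide_opp_r; apply: z.
move=> /andP [ij j3]; have i3 : (i < 3)%N by exact: (ltn_trans ij j3).
apply: G; case: (z i i3) (z j j3) (rE i) (rE j) => [a Ea] [b Eb] [c Ec] [d Ed].
have := plucker i.+1 j.+1 0%nat; rewrite (anti 0%nat) Ea Eb Ec Ed => E.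
by exists (a * d * 3 - b * c * 3); lia.
Qed.

Lemma node_shape n : In n nodes ->
  [/\ dot n.1 n.1 mod 3 = 1, ~ Z.divide 5 (dot n.2 n.2)
    & par 3 n.1 (V 1 1 1 1) \/ par 3 n.1 (V 1 0 0 0)].
Proof.
move=> Hn; split.
- by have := everybP _ _ _ nodes_prim Hn; case: ifP => // /Z.eqb_eq.
- have := everybP _ _ _ nodes_prim Hn; case: ifP => // _ /not_dvd5E //.
- have H : everyb (fun n : vec * vec => if parb 3 n.1 (V 1 1 1 1) then true
      else parb 3 n.1 (V 1 0 0 0)) nodes by vm_compute.
  have := everybP _ _ _ H Hn; case: ifP => [|_] /(parP 3 _ _ erefl) ?; [by left | by right].
Qed.

(** From 9 to 27, [start_node] gives a node modulo 27 and [nodes_rigid] identifies it. Afterwards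
    the neighbours of v lie on neighbouring nodes with one power less, the induction hypothesis
    restores that power, and [lift_par] gains one. *)
Lemma node_lift X k v n : trapped X -> X v -> In n nodes ->
  par (3 ^ Z.of_nat k.+2) v n.1 -> par 5 v n.2 -> par (3 ^ Z.of_nat k.+3) v n.1.
Proof.
move=> T; elim: k v n => [|k IH] v n Xv Hn H3 H5; have [n1 n2 nA] := node_shape n Hn.
  have [f [m [Sf Hm F3 F5]]] := start_node X v T Xv.
  have [m1 m2 _] := node_shape m Hm.
  have v1 := trap3 _ T _ Xv; have v5 := trap5 _ T _ Xv.
  have [g gin fg] := syms_complete _ Sf; have Sg := syms_sym _ gin.
  rewrite !fg in F3 F5.
  have := everybP _ _ _ (everybP _ _ _ (everybP _ _ _ nodes_rigid gin) Hn) Hm.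
  have c9 x : x mod 3 = 1 -> rel_prime 9 x := cop3 2 x.
  have c27 x : x mod 3 = 1 -> rel_prime 27 x := cop3 3 x.
  have P9 : par 9 (g n.1) m.1.
    apply: (par_trans _ _ (g v)); first by rewrite (dot_sym _ Sg); apply: c9.
      by apply/par_sym/par_symE.
    by apply: par_dvd F3; exists 3.
  have P5 : par 5 (g n.2) m.2.
    apply: (par_trans _ _ (g v)) => //; first by rewrite (dot_sym _ Sg); apply: cop5.
    by apply/par_sym/par_symE.
  rewrite (proj2 (parP 9 _ _ erefl) P9) (proj2 (parP 5 _ _ erefl) P5).
  move=> /(parP 27 _ _ erefl) P27; apply/(par_symE _ Sg).
  by apply: (par_trans 27 _ m.1); [apply: c27 | | apply: par_sym].
apply: lift_par => // u Hu Du.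
have Dv := dvd3_dot _ _ _ _ n1 H3 Du.
have Tv := trap_move _ T _ _ Hu Dv Xv.
have := everybP _ _ _ (everybP _ _ _ nodes_closed Hn) Hu.
case: ifP => [_|/Z.eqb_neq]; last by move=> []; apply/Z.mod_divide.
rewrite /is_node; case: ifP => // /not_dvd5E s5.
move=> /(anybP _ _) [f /syms_sym Sf /(anybP _ _) [m Hm]].
case: ifP => // /(parP 5 _ _ erefl) F5 /veqbP F3.
apply/(par_symE _ Sf); rewrite F3; apply: IH => //.
- exact: (trap_sym _ T).
- by rewrite -F3; apply/par_symE => //; apply: par_move3; rewrite -?pow3S.
- apply: par_trans F5; first by rewrite (dot_sym _ Sf); apply: cop5.
  by apply/par_symE => //; apply: par_move5.
Qed.

Definition lines : list vec :=
  V 1 0 0 0 :: V 1 0 3 6 :: V (-5) 1 4 (-2) ::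
    V 7 0 3 6 :: V (-2) 0 9 3 :: V (-5) 1 (-2) (-8) :: V (-5) 4 7 (-2) ::
    V (-2) (-5) (-5) (-5) :: V (-5) 6 3 3 :: V (-5) 1 7 (-2) :: nil.

(** Minors divisible by every power of 3 are zero, so v is exactly proportional to the node, whose
    two components must then agree modulo 5. *)
Lemma trapped_line X v : trapped X -> X v ->
  exists w r c, [/\ X w, In r lines & forall i, co w i = c * co r i].
Proof.
move=> T Xv; have [f [n [Sf Hn F3 F5]]] := start_node X v T Xv.
have Xf := trap_sym _ T _ Sf _ Xv; move: (f v) Xf F3 F5 => w Xw F3 F5.
have [n1 n2 _] := node_shape n Hn.
have P k : par (3 ^ Z.of_nat k.+3) w n.1.
  by elim: k => [|k IH]; [exact: F3 | apply: node_lift T Xw Hn IH F5].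
have E i j : co w i * co n.1 j = co w j * co n.1 i.
  suff : co w i * co n.1 j - co w j * co n.1 i = 0 by lia.
  move: (co w i * _ - _) (fun k => P k i j) => x Hx.
  case: (Z.eq_dec x 0) => // x0; exfalso.
  have /Z.divide_abs_r /Z.divide_pos_le := Hx (Z.to_nat (Z.abs x)).
  have := Z.pow_gt_lin_r 3 (Z.of_nat (Z.to_nat (Z.abs x)).+3) ltac:(lia) ltac:(lia).
  by lia.
have M : par 5 n.1 n.2.
  apply: par_trans F5; first by apply/cop5/(trap5 _ T).
  by move=> i j; exists 0; have := E i j; lia.
(* A vector b with [dot b r = 1] shows that r is primitive and w is [dot b w] times r. *)
have : everyb (fun n : vec * vec => if parb 5 n.1 n.2 then
    anyb (fun r => if veqb r n.1 then
      anyb (fun b => dot b r =? 1) (vecs (0 :: 1 :: -1 :: 2 :: -2 :: nil)) else false) lines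
    else true) nodes by vm_compute.
move=> /(everybP _ _ n) /(_ Hn); rewrite (proj2 (parP 5 _ _ erefl) M).
move=> /(anybP _ _) [r Hr]; case: ifP => // /veqbP Er /(anybP _ _) [b _ /Z.eqb_eq Eb].
exists w, r, (dot b w); split => // i.
rewrite -[LHS]Z.mul_1_r -Eb /dot; move: (E i); rewrite -Er => {}E.
transitivity (co b 0 * (co w i * co r 0) + co b 1 * (co w i * co r 1)
  + co b 2 * (co w i * co r 2) + co b 3 * (co w i * co r 3)); first by ring.
by rewrite !E; ring.
Qed.

(** * Lagrange's four square theorem *)

(** The quaternion product of w with the conjugate of v; the conjugate makes it divisible by m when
    v and w agree modulo m. *)
Definition quat_mul (v w : vec) : vec :=
  let: V a b c d := v in let: V x y z t := w in
  V (a * x + b * y + c * z + d * t) (a * y - b * x + c * t - d * z)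
    (a * z - c * x + d * y - b * t) (a * t - d * x + b * z - c * y).

Lemma dot_quat_mul v w : dot (quat_mul v w) (quat_mul v w) = dot v v * dot w w.
Proof. by case: v => a b c d; case: w => x y z t; rewrite /dot /=; ring. Qed.

Lemma centered m a : 0 < m -> exists b t, [/\ a = b + m * t, - m < 2 * b & 2 * b <= m].
Proof.
move=> m0; have E := Z.div_mod a m; have R := Z.mod_pos_bound a m m0.
case: (Z_le_gt_dec (2 * (a mod m)) m) => C; [exists (a mod m), (a / m)|exists (a mod m - m), (a / m + 1)].
  by split; lia.
by split; lia.
Qed.

(** Reducing v modulo m to centred residues gives norm m r with r at most m; the product of the two
    quaternions is m times the new vector. *)
Lemma descent p m v : Znumtheory.prime p -> 1 < m < p -> dot v v = m * p ->
  exists r w, 0 < r < m /\ dot w w = r * p.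
Proof.
move=> p_pr [m1 mp].
have m_ndvd : ~ Z.divide m p by case: (proj2 (prime_alt p) p_pr) => _; apply.
case: v => a b c d.
have m0 : 0 < m by lia.
have [a' [ta [-> a1 a2]]] := centered m a m0; have [b' [tb [-> b1 b2]]] := centered m b m0.
have [c' [tc [-> c1 c2]]] := centered m c m0; have [d' [td [-> d1 d2]]] := centered m d m0.
rewrite /dot /= => E.
pose r := p - (2 * (a' * ta + b' * tb + c' * tc + d' * td)
     + m * (ta * ta + tb * tb + tc * tc + td * td)).
have Er : a' * a' + b' * b' + c' * c' + d' * d' = m * r.
  by rewrite /r Z.mul_sub_distr_l -E; ring.
have bnd x : - m < 2 * x -> 2 * x <= m -> 4 * (x * x) <= m * m by nia.
have Ba := bnd _ a1 a2; have Bb := bnd _ b1 b2; have Bc := bnd _ c1 c2; have Bd := bnd _ d1 d2.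
have r_le : r <= m by nia.
have r_ge : 0 <= r by nia.
have r0 : r <> 0.
  move=> r0; rewrite r0 Z.mul_0_r in Er.
  have [za [zb [zc zd]]] : a' = 0 /\ b' = 0 /\ c' = 0 /\ d' = 0 by nia.
  apply: m_ndvd; exists (ta * ta + tb * tb + tc * tc + td * td).
  by apply: (Z.mul_reg_l _ _ m); [lia | rewrite -E za zb zc zd; ring].
(* Equality forces every centred residue to be m/2, and then m squared divides m p. *)
have rm : r <> m.
  move=> rm; rewrite rm in Er.
  have hx x : - m < 2 * x -> 2 * x <= m -> 4 * (x * x) = m * m -> m = 2 * x by nia.
  have ha := hx _ a1 a2 ltac:(lia); have hb := hx _ b1 b2 ltac:(lia).
  have hc := hx _ c1 c2 ltac:(lia); have hd := hx _ d1 d2 ltac:(lia).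
  have [eb ec ed] : [/\ b' = a', c' = a' & d' = a'] by split; lia.
  apply: m_ndvd; exists (1 + ta + tb + tc + td + (ta * ta + tb * tb + tc * tc + td * td)).
  apply: (Z.mul_reg_l _ _ m); first lia.
  by rewrite -E eb ec ed ha; ring.
pose w := V (r + a' * ta + b' * tb + c' * tc + d' * td)
  (ta * b' - tb * a' + tc * d' - td * c') (ta * c' - tc * a' + td * b' - tb * d')
  (ta * d' - td * a' + tb * c' - tc * b').
exists r, w; split; first lia.
have mm : m * m <> 0 by nia.
apply: (Z.mul_reg_l _ _ (m * m)) => //.
transitivity (dot (V (a' + m * ta) (b' + m * tb) (c' + m * tc) (d' + m * td))
  (V (a' + m * ta) (b' + m * tb) (c' + m * tc) (d' + m * td)) * dot (V a' b' c' d') (V a' b' c' d')).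
  rewrite -dot_quat_mul.
  transitivity (dot (lin (V 0 0 0 0) m w) (lin (V 0 0 0 0) m w)).
    by rewrite /dot !co_lin; cbn [co]; ring.
  congr dot; rewrite /lin /w /=; congr V; nia.
rewrite {1}/dot /= E {1}/dot /= Er; ring.
Qed.

Lemma four_squares_prime (p : nat) : prime p -> exists v, dot v v = Z.of_nat p.
Proof.
move=> p_pr; have := prime_Z p p_pr.
case: (even_prime p_pr) => [-> _|p_odd pz]; first by exists (V 1 1 0 0).
have [m [v [m1 E]]] : exists m v, 0 < m < Z.of_nat p /\ dot v v = m * Z.of_nat p.
  have [a [b [/leP ha /leP hb /dvdnP [q Eq]]]] := sum_two_squares_m1_mod p p_pr p_odd.
  have {}Eq : Z.of_nat a * Z.of_nat a + Z.of_nat b * Z.of_nat b + 1 = Z.of_nat q * Z.of_nat p.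
    move: (congr1 Z.of_nat Eq); rewrite -!mulnn -plusE -multE.
    by rewrite !Nat2Z.inj_add !Nat2Z.inj_mul.
  exists (Z.of_nat q), (V (Z.of_nat a) (Z.of_nat b) 1 0); split; last by rewrite -Eq /dot /=; lia.
  have p2 := prime_ge_2 _ pz; rewrite -multE in ha hb.
  move: p2 Eq.
  have : 2 * Z.of_nat a < Z.of_nat p by lia.
  have : 2 * Z.of_nat b < Z.of_nat p by lia.
  have : 0 <= Z.of_nat a by lia.
  have : 0 <= Z.of_nat b by lia.
  move: (Z.of_nat a) (Z.of_nat b) (Z.of_nat q) (Z.of_nat p) => A B Q P B0 A0 hB hA P2 Eq.
  have : 4 * (A * A) < P * P by nia.
  have : 4 * (B * B) < P * P by nia.
  by split; nia.
have : forall k m v, 0 < m < Z.of_nat p -> m <= Z.of_nat k ->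
    dot v v = m * Z.of_nat p -> exists v, dot v v = Z.of_nat p.
  elim=> [|k IH] {E m1 m v} m v m1 mk E; first lia.
  case: (Z.eq_dec m 1) => [E1|m_neq1]; first by exists v; rewrite E E1; lia.
  have [r [w [r1 Ew]]] := descent _ m v pz ltac:(lia) E.
  by apply: (IH r w) => //; lia.
by move=> /(_ (Z.to_nat m) m v m1); apply=> //; lia.
Qed.

Lemma four_squares (n : nat) : exists v, dot v v = Z.of_nat n.
Proof.
elim/ltn_ind: n => n IH.
case: (leqP n 1) => [|n1]; first by case: n {IH} => [|[|n]] // _; [exists (V 0 0 0 0) | exists (V 1 0 0 0)].
have [u Eu] := four_squares_prime _ (pdiv_prime n1).
have [v Ev] := IH (n %/ pdiv n) (ltn_Pdiv (prime_gt1 (pdiv_prime n1)) (ltnW n1)).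
exists (quat_mul u v); rewrite dot_quat_mul Eu Ev -Nat2Z.inj_mul multE.
by rewrite mulnC divnK // pdiv_dvd.
Qed.

(** * Primes above 5 *)

Definition zero_or_ndvd (p x : Z) : Prop := x = 0 \/ ~ Z.divide p x.

(** Zeros stand for absent squares, so that fewer than four squares are covered. *)
Definition good (p n : Z) : Prop := exists a b c d,
  a * a + b * b + c * c + d * d = n /\
  [/\ zero_or_ndvd p a, zero_or_ndvd p b, zero_or_ndvd p c & zero_or_ndvd p d].

Lemma good_ndvd p n a b c d : a * a + b * b + c * c + d * d = n ->
  ~ Z.divide p a -> ~ Z.divide p b -> ~ Z.divide p c -> ~ Z.divide p d -> good p n.
Proof. by move=> E *; exists a, b, c, d; split => //; split; right. Qed.

Lemma ndvd_mul p x y : Znumtheory.prime p -> ~ Z.divide p x -> ~ Z.divide p y ->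
  ~ Z.divide p (x * y).
Proof. by move=> pr Hx Hy /(prime_mult _ pr) []. Qed.

Lemma ndvd_small p x : 0 < Z.abs x < p -> ~ Z.divide p x.
Proof. by move=> [x0 xp] /Z.divide_abs_r /Z.divide_pos_le; lia. Qed.

(** With signs chosen so that coordinates are 1 modulo 3, any three of them admit the reflection in
    (1, 1, 1), which subtracts 2k from each. *)
Lemma reflect3 a b c : a mod 3 = 1 -> b mod 3 = 1 -> c mod 3 = 1 ->
  exists k, a + b + c = 3 * k.
Proof. by move=> Ha Hb Hc; exists (a / 3 + b / 3 + c / 3 + 1); mlia. Qed.

Lemma ndvd_third p k t x y : Znumtheory.prime p -> 5 <= p ->
  0 < Z.abs t < p -> ~ Z.divide p k -> Z.divide p (x - t * k) -> x = 3 * y -> ~ Z.divide p y.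
Proof.
move=> pr p5 tp Hk [q Hq] E [z Ez].
by case: (ndvd_mul p t k pr (ndvd_small _ _ tp) Hk); exists (3 * z - q); lia.
Qed.

(** Reflecting (b, c, d) gives b/3, -2b/3, -2b/3 modulo p. *)
Lemma good_two_zeros p n a b c d : Znumtheory.prime p -> 5 <= p ->
  a * a + b * b + c * c + d * d = n ->
  a mod 3 = 1 -> b mod 3 = 1 -> c mod 3 = 1 -> d mod 3 = 1 ->
  ~ Z.divide p a -> ~ Z.divide p b -> Z.divide p c -> Z.divide p d -> good p n.
Proof.
move=> pr p5 En a3 b3 c3 d3 Ha Hb [qc Ec] [qd Ed].
have [k Ek] := reflect3 b c d b3 c3 d3.
apply: (good_ndvd p n a (b - 2 * k) (c - 2 * k) (d - 2 * k)) => //; first nia.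
- apply: (ndvd_third p b 1 (b - 2 * c - 2 * d)) => //; [lia| |lia].
  by exists (- 2 * qc - 2 * qd); lia.
- apply: (ndvd_third p b (-2) (c - 2 * b - 2 * d)) => //; [lia| |lia].
  by exists (qc - 2 * qd); lia.
- apply: (ndvd_third p b (-2) (d - 2 * b - 2 * c)) => //; [lia| |lia].
  by exists (qd - 2 * qc); lia.
Qed.

(** Modulo p, three times the reflection of (b, c, d) is (b - 2c, c - 2b, -2b - 2c); failure fixes
    the ratio of b and c. *)
Lemma good_or_ratio p n a b c d : Znumtheory.prime p -> 5 <= p ->
  a * a + b * b + c * c + d * d = n ->
  b mod 3 = 1 -> c mod 3 = 1 -> d mod 3 = 1 ->
  ~ Z.divide p a -> Z.divide p d ->
  good p n \/ exists x y,
    In (x, y) ((1, -2) :: (-2, 1) :: (1, 1) :: nil) /\ Z.divide p (x * b + y * c).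
Proof.
move=> pr p5 En b3 c3 d3 Ha [qd Ed].
have [k Ek] := reflect3 b c d b3 c3 d3.
case: (classic (Z.divide p (b - 2 * k))) => [[q Hq]|Hb].
  by right; exists 1, (-2); split; [left | exists (3 * q + 2 * qd); lia].
case: (classic (Z.divide p (c - 2 * k))) => [[q Hq]|Hc].
  by right; exists (-2), 1; split; [right; left | exists (3 * q + 2 * qd); lia].
case: (classic (Z.divide p (d - 2 * k))) => [[q Hq]|Hd].
  right; exists 1, 1; split; first by right; right; left.
  have : Z.divide p (2 * (1 * b + 1 * c)) by exists (qd - 3 * q); lia.
  by case/(prime_mult _ pr) => // /(ndvd_small p 2 ltac:(lia)).
by left; apply: (good_ndvd p n a (b - 2 * k) (c - 2 * k) (d - 2 * k)) => //; nia.
Qed.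

(** If the reflections of all three pairs together with d fail, the three ratios close up to a cycle
    whose determinant p must divide. *)
Lemma good_one_zero p n a b c d : Znumtheory.prime p -> 5 < p -> ~ Z.divide p n ->
  a * a + b * b + c * c + d * d = n ->
  a mod 3 = 1 -> b mod 3 = 1 -> c mod 3 = 1 -> d mod 3 = 1 ->
  ~ Z.divide p a -> ~ Z.divide p b -> ~ Z.divide p c -> Z.divide p d -> good p n.
Proof.
move=> pr p5 Hn En a3 b3 c3 d3 Ha Hb Hc Hd.
case: (good_or_ratio p n a b c d) => //; first lia.
move=> [x1 [y1 [I1 [q1 E1]]]].
case: (good_or_ratio p n b c a d) => //; [lia|lia|].
move=> [x2 [y2 [I2 [q2 E2]]]].
case: (good_or_ratio p n c a b d) => //; [lia|lia|].
move=> [x3 [y3 [I3 [q3 E3]]]].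
have D : Z.divide p ((x1 * x2 * x3 + y1 * y2 * y3) * a).
  exists (x1 * x2 * q3 - y3 * x2 * q1 + y3 * y1 * q2).
  transitivity (x1 * x2 * (q3 * p) - y3 * x2 * (q1 * p) + y3 * y1 * (q2 * p)); last ring.
  by rewrite -E1 -E2 -E3; ring.
case/(prime_mult _ pr): D => // D.
exfalso.
move: I1 I2 I3 => /= [[]|[[]|[[]|//]]] ? ? [[]|[[]|[[]|//]]] ? ? [[]|[[]|[[]|//]]] ? ?; subst.
(* The determinant is nonzero of absolute value at most 5, except for -7 when the three ratios are
   equal to 2 or all equal to 1/2. *)
all: try by move: D; apply: ndvd_small; lia.
all: have P7 : p = 7 by
  have := Z.divide_pos_le p 7 ltac:(lia) (proj1 (Z.divide_opp_r p 7) D);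
  case: (Z.eq_dec p 6) => [E6|]; [case: D => q; rewrite E6; lia | lia].
(* The coordinates are in ratio 1 : 2 : 4 up to order, so the norm is 21 times a square modulo 7. *)
all: subst p; apply: Hn.
- case: Hd => qd Ed; have Eb : b = 2 * c + q1 * 7 by lia. have Ec : c = 2 * a + q2 * 7 by lia.
  have [s Es] : exists s, b = 4 * a + 7 * s by exists (2 * q2 + q1); lia.
  exists (3 * a * a + 8 * a * s + 7 * s * s + 4 * a * q2 + 7 * q2 * q2 + 7 * qd * qd).
  by rewrite Ed Es Ec; ring.
- case: Hd => qd Ed; have Ec : c = 2 * b + q1 * 7 by lia. have Ea : a = 2 * c + q2 * 7 by lia.
  have [s Es] : exists s, a = 4 * b + 7 * s by exists (2 * q1 + q2); lia.
  exists (3 * b * b + 8 * b * s + 7 * s * s + 4 * b * q1 + 7 * q1 * q1 + 7 * qd * qd).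
  by rewrite Ed Es Ec; ring.
Qed.

(** One or two reflections that leave b alone make at least two coordinates prime to p and all prime
    to 3; [fin] then applies the previous cases. *)
Lemma good_three_zeros p n a b c d : Znumtheory.prime p -> 5 < p -> ~ Z.divide p n ->
  a * a + b * b + c * c + d * d = n ->
  a mod 3 = 1 -> b mod 3 = 1 -> c mod 3 = 1 -> d mod 3 = 1 ->
  ~ Z.divide p a -> Z.divide p b -> Z.divide p c -> Z.divide p d -> good p n.
Proof.
move=> pr p5 Hn En a3 b3 c3 d3 Ha Hb Hc Hd.
have p5' : 5 <= p by lia.
have fin x y z e : e = 1 \/ e = -1 -> b * b + x * x + y * y + z * z = n ->
    (e * x) mod 3 = 1 -> (e * y) mod 3 = 1 -> (e * z) mod 3 = 1 ->
    ~ Z.divide p y -> ~ Z.divide p z -> good p n.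
  move=> He E x3 y3 z3 Hy Hz.
  have He' t : ~ Z.divide p t -> ~ Z.divide p (e * t).
    by move=> Ht; apply: ndvd_mul => //; apply: ndvd_small; lia.
  have ee : e * e = 1 by nia.
  case: (classic (Z.divide p (e * x))) => Hx.
    apply: (good_two_zeros p n (e * y) (e * z) (e * x) b) => //; try exact: He'.
    by rewrite -E; nia.
  apply: (good_one_zero p n (e * y) (e * z) (e * x) b) => //; try exact: He'.
  by rewrite -E; nia.
have unit3 x : x mod 3 <> 0 -> exists e, (e = 1 \/ e = -1) /\ (e * x) mod 3 = 1.
  move=> x3; have := Z.mod_pos_bound x 3 ltac:(lia).
  case: (Z.eq_dec (x mod 3) 1) => x1 xb; [exists 1 | exists (-1)]; split; mlia.
have [k Ek] := reflect3 a c d a3 c3 d3.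
case: (Hc) (Hd) => [qc Ec] [qd Ed].
set a1 := a - 2 * k; set c1 := c - 2 * k; set d1 := d - 2 * k.
have E1 : b * b + a1 * a1 + c1 * c1 + d1 * d1 = n by rewrite /a1 /c1 /d1; nia.
have Hc1 : ~ Z.divide p c1.
  apply: (ndvd_third p a (-2) (c - 2 * a - 2 * d)) => //; [lia| |rewrite /c1; lia].
  by exists (qc - 2 * qd); lia.
have Hd1 : ~ Z.divide p d1.
  apply: (ndvd_third p a (-2) (d - 2 * a - 2 * c)) => //; [lia| |rewrite /d1; lia].
  by exists (qd - 2 * qc); lia.
(* The reflected coordinates are 1 + k modulo 3, so only k = 2 makes them divisible by 3. *)
case: (Z.eq_dec (k mod 3) 2) => k2; last first.
  have [e [He e1]] := unit3 (1 + k) ltac:(mlia).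
  by apply: (fin a1 c1 d1 e) => //; rewrite /a1 /c1 /d1; case: He e1 => ->; mlia.
have d3' x : x mod 3 = 1 -> exists t, x - 2 * k = 3 * t.
  by move=> x3; exists (x / 3 - 2 * (k / 3) - 1); mlia.
have [a2 Ea2] := d3' a a3; have [c2 Ec2] := d3' c c3; have [d2 Ed2] := d3' d d3.
have S : a2 + c2 + d2 = - k by lia.
have Fa : 9 * a2 = a - 2 * c - 2 * d by lia.
have Fc : 9 * c2 = c - 2 * a - 2 * d by lia.
have Fd : 9 * d2 = d - 2 * a - 2 * c by lia.
have n3 t x y : 0 < Z.abs t < p -> Z.divide p (x - t * a) -> x = 9 * y -> ~ Z.divide p y.
  move=> tp [q Hq] E [z Ez].
  by case: (ndvd_mul p t a pr (ndvd_small _ _ tp) Ha); exists (9 * z - q); lia.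
have E2 : b * b + 9 * (a2 * a2 + c2 * c2 + d2 * d2) = n.
  by rewrite -E1 /a1 /c1 /d1 Ea2 Ec2 Ed2; ring.
have sgn3 s e x t : e = 1 \/ e = -1 -> (e * s) mod 3 = 1 -> x = s + 3 * t -> (e * x) mod 3 = 1.
  by clear; move=> He e1 ->; case: He e1 => ->; mlia.
(* A second reflection of 3 (a2, c2, d2), in some u with entries 1 or -1, has coordinates s or -s
   modulo 3, where s = u . (a2, c2, d2). *)
case: (Z.eq_dec ((- a2 + c2 + d2) mod 3) 0) => [s1|]; last first.
  set s := - a2 + c2 + d2; move=> s1; have [e [He e1]] := unit3 s s1.
  apply: (fin (- (3 * a2 + 2 * s)) (3 * c2 - 2 * s) (3 * d2 - 2 * s) e) => //.
  - by rewrite -E2 /s; ring.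
  - by apply: (sgn3 s e _ (- a2 - s)) => //; ring.
  - by apply: (sgn3 s e _ (c2 - s)) => //; ring.
  - by apply: (sgn3 s e _ (d2 - s)) => //; ring.
  - apply: (n3 4 (4 * a + c - 8 * d)); [lia | | rewrite /s; lia].
    by exists (qc - 8 * qd); rewrite Ec Ed; ring.
  - apply: (n3 4 (4 * a + d - 8 * c)); [lia | | rewrite /s; lia].
    by exists (qd - 8 * qc); rewrite Ec Ed; ring.
(* The three candidate values of s add up to a2 + c2 + d2 = -k, which is nonzero modulo 3. *)
have some : (a2 + c2 - d2) mod 3 <> 0 \/ (a2 + d2 - c2) mod 3 <> 0.
  by move: S s1 k2; clear; mlia.
case: some => t1.
  set s := a2 + c2 - d2 in t1; have [e [He e1]] := unit3 s t1.
  apply: (fin (3 * c2 - 2 * s) (3 * a2 - 2 * s) (- (3 * d2 + 2 * s)) e) => //.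
  - by rewrite -E2 /s; ring.
  - by apply: (sgn3 s e _ (c2 - s)) => //; ring.
  - by apply: (sgn3 s e _ (a2 - s)) => //; ring.
  - by apply: (sgn3 s e _ (- d2 - s)) => //; ring.
  - apply: (n3 1 (a - 8 * c + 4 * d)); [lia | | rewrite /s; lia].
    by exists (4 * qd - 8 * qc); rewrite Ec Ed; ring.
  - apply: (n3 4 (4 * a + 4 * c + 7 * d)); [lia | | rewrite /s; lia].
    by exists (4 * qc + 7 * qd); rewrite Ec Ed; ring.
set s := a2 + d2 - c2 in t1; have [e [He e1]] := unit3 s t1.
apply: (fin (3 * d2 - 2 * s) (3 * a2 - 2 * s) (- (3 * c2 + 2 * s)) e) => //.
- by rewrite -E2 /s; ring.
- by apply: (sgn3 s e _ (d2 - s)) => //; ring.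
- by apply: (sgn3 s e _ (a2 - s)) => //; ring.
- by apply: (sgn3 s e _ (- c2 - s)) => //; ring.
- apply: (n3 1 (a - 8 * d + 4 * c)); [lia | | rewrite /s; lia].
  by exists (4 * qc - 8 * qd); rewrite Ec Ed; ring.
- apply: (n3 4 (4 * a + 4 * d + 7 * c)); [lia | | rewrite /s; lia].
  by exists (4 * qd + 7 * qc); rewrite Ec Ed; ring.
Qed.

Definition unit_rep (n : Z) : Prop := exists a b c d,
  [/\ a * a + b * b + c * c + d * d = n, a mod 3 = 1, b mod 3 = 1, c mod 3 = 1 & d mod 3 = 1].

Lemma sqr_mod3 x : (x mod 3 = 0 /\ exists q, x * x = 3 * q) \/
  (x mod 3 <> 0 /\ exists q, x * x = 3 * q + 1).
Proof.
have := Z.div_mod x 3 ltac:(lia); have := Z.mod_pos_bound x 3 ltac:(lia).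
move: (x / 3) (x mod 3) => q r r3 ->.
have [->|[->|->]] : r = 0 \/ r = 1 \/ r = 2 by lia.
- by left; split => //; exists (3 * q * q); ring.
- by right; split => //; exists (3 * q * q + 2 * q); ring.
- by right; split => //; exists (3 * q * q + 4 * q + 1); ring.
Qed.

Lemma unit_rep_intro n a b c d : a * a + b * b + c * c + d * d = n ->
  a mod 3 <> 0 -> b mod 3 <> 0 -> c mod 3 <> 0 -> d mod 3 <> 0 -> unit_rep n.
Proof.
have sg x : x mod 3 <> 0 -> exists y, y * y = x * x /\ y mod 3 = 1.
  move=> x3; have := Z.mod_pos_bound x 3 ltac:(lia).
  case: (Z.eq_dec (x mod 3) 1) => x1 xb; [exists x | exists (- x)]; split => //; first ring.
  by mlia.
move=> E /sg [a' [Ea a1]] /sg [b' [Eb b1]] /sg [c' [Ec c1]] /sg [d' [Ed d1]].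
by exists a', b', c', d'; rewrite Ea Eb Ec Ed.
Qed.

(* Each reflection in a suitable (1, +-1, +-1) removes one factor 3 from the last
   three coordinates. *)
Lemma unit_rep_climb n j x y z w : n mod 3 = 1 -> x mod 3 <> 0 ->
  ~ (y mod 3 = 0 /\ z mod 3 = 0 /\ w mod 3 = 0) ->
  x * x + 9 ^ Z.of_nat j * (y * y + z * z + w * w) = n -> unit_rep n.
Proof.
move=> n1 x3; elim: j y z w => [|j IH] y z w yzw E.
  rewrite Z.pow_0_r Z.mul_1_l in E.
  have [y3 z3 w3] : [/\ y mod 3 <> 0, z mod 3 <> 0 & w mod 3 <> 0].
    case: (sqr_mod3 x) (sqr_mod3 y) (sqr_mod3 z) (sqr_mod3 w)
      => [[? [? ?]]|[? [? ?]]] [[? [? ?]]|[? [? ?]]] [[? [? ?]]|[? [? ?]]] [[? [? ?]]|[? [? ?]]];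
      solve [split; lia | by case: yzw | exfalso; move: n1; rewrite -E; mlia].
  by apply: (unit_rep_intro n x y z w) => //; lia.
have [e [f [s [He Hf Es s3]]]] : exists e f s,
    [/\ e * e = 1, f * f = 1, s = y + e * z + f * w & s mod 3 <> 0].
  case: (Z.eq_dec ((y + z + w) mod 3) 0) => [s1|]; last first.
    by exists 1, 1, (y + z + w); split => //; ring.
  case: (Z.eq_dec ((y + z - w) mod 3) 0) => [s2|]; last first.
    by exists 1, (-1), (y + z - w); split => //; ring.
  case: (Z.eq_dec ((y - z + w) mod 3) 0) => [s4|]; last first.
    by exists (-1), 1, (y - z + w); split => //; ring.
  by case: yzw; move: s1 s2 s4; clear; split; [|split]; mlia.
apply: (IH (3 * y - 2 * s) (3 * z - 2 * (e * s)) (3 * w - 2 * (f * s))).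
  by move=> [] + _; move: s3; clear; mlia.
rewrite -E Nat2Z.inj_succ Z.pow_succ_r; last lia.
have -> : (3 * y - 2 * s) * (3 * y - 2 * s) + (3 * z - 2 * (e * s)) * (3 * z - 2 * (e * s))
    + (3 * w - 2 * (f * s)) * (3 * w - 2 * (f * s))
  = 9 * (y * y + z * z + w * w) - 12 * (s * (y + e * z + f * w))
    + 4 * (s * s) * (1 + e * e + f * f) by ring.
by rewrite He Hf -Es; ring.
Qed.

Lemma pow9_split k y z w : Z.abs y + Z.abs z + Z.abs w <= Z.of_nat k ->
  (y = 0 /\ z = 0 /\ w = 0) \/ exists (j : nat) y' z' w',
  ~ (y' mod 3 = 0 /\ z' mod 3 = 0 /\ w' mod 3 = 0) /\
  y * y + z * z + w * w = 9 ^ Z.of_nat j * (y' * y' + z' * z' + w' * w').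
Proof.
elim: k y z w => [|k IH] y z w Hk; first by left; lia.
case: (classic (y mod 3 = 0 /\ z mod 3 = 0 /\ w mod 3 = 0)) => [[]|H]; last first.
  by right; exists 0%nat, y, z, w; split => //; rewrite Z.pow_0_r; ring.
move=> /Z.mod_divide [] // y' Ey [/Z.mod_divide [] // z' Ez /Z.mod_divide [] // w' Ew].
case: (classic (y = 0 /\ z = 0 /\ w = 0)) => [|H]; first by left.
case: (IH y' z' w'); [lia|lia|].
move=> [j [y2 [z2 [w2 [H2 E2]]]]]; right; exists j.+1, y2, z2, w2; split => //.
rewrite Nat2Z.inj_succ Z.pow_succ_r; last lia.
by rewrite -Z.mul_assoc -E2 Ey Ez Ew; ring.
Qed.

(** Some coordinate x is prime to 3. Either the other three vanish and n is a square, or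
    [unit_rep_climb] removes their common power of 3. *)
Lemma unit_rep_exists n v : n mod 3 = 1 -> dot v v = n ->
  (exists c, n = c * c) \/ unit_rep n.
Proof.
have one x y z w : n mod 3 = 1 -> x mod 3 <> 0 -> x * x + y * y + z * z + w * w = n ->
    (exists c, n = c * c) \/ unit_rep n.
  move=> n1 x3 E.
  case: (pow9_split (Z.to_nat (Z.abs y + Z.abs z + Z.abs w)) y z w); first lia.
    by move=> [Ey [Ez Ew]]; left; exists x; rewrite -E Ey Ez Ew; ring.
  move=> [j [y' [z' [w' [H E']]]]]; right; apply: (unit_rep_climb n j x y' z' w') => //.
  by rewrite -E' -E; ring.
case: v => a b c d n1; rewrite /dot; cbn [co] => E.
case: (sqr_mod3 a) => [[a0 [qa Ea]]|[a3 _]]; last exact: (one a b c d).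
case: (sqr_mod3 b) => [[b0 [qb Eb]]|[b3 _]]; last by apply: (one b a c d) => //; lia.
case: (sqr_mod3 c) => [[c0 [qc Ec]]|[c3 _]]; last by apply: (one c a b d) => //; lia.
case: (sqr_mod3 d) => [[d0 [qd Ed]]|[d3 _]]; last by apply: (one d a b c) => //; lia.
by exfalso; move: n1; rewrite -E Ea Eb Ec Ed; clear; mlia.
Qed.

Lemma good_square p c : Znumtheory.prime p -> ~ Z.divide p (c * c) -> good p (c * c).
Proof.
move=> pr H; exists c, 0, 0, 0; split; first ring.
by split; [right => D; apply: H; apply: Z.divide_mul_l | left | left | left].
Qed.

Lemma good_large p n : Znumtheory.prime p -> 5 < p -> ~ Z.divide p n ->
  n mod 3 = 1 -> (exists v, dot v v = n) -> good p n.
Proof.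
move=> pr p5 Hn n1 [v Ev].
case: (unit_rep_exists n v n1 Ev) => [[c Ec]|]; first by rewrite Ec in Hn *; apply: good_square.
move=> [a [b [c [d [E a1 b1 c1 d1]]]]]; have p5' : 5 <= p by lia.
case: (classic (Z.divide p a)) => Ha; case: (classic (Z.divide p b)) => Hb;
  case: (classic (Z.divide p c)) => Hc; case: (classic (Z.divide p d)) => Hd.
- by case: Hn; rewrite -E; do !apply: Z.divide_add_r; apply: Z.divide_mul_l.
- by apply: (good_three_zeros p n d a b c) => //; lia.
- by apply: (good_three_zeros p n c a b d) => //; lia.
- by apply: (good_two_zeros p n c d a b) => //; lia.
- by apply: (good_three_zeros p n b a c d) => //; lia.
- by apply: (good_two_zeros p n b d a c) => //; lia.
- by apply: (good_two_zeros p n b c a d) => //; lia.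
- by apply: (good_one_zero p n b c d a) => //; lia.
- by apply: (good_three_zeros p n a b c d) => //; lia.
- by apply: (good_two_zeros p n a d b c) => //; lia.
- by apply: (good_two_zeros p n a c b d) => //; lia.
- by apply: (good_one_zero p n a c d b) => //; lia.
- exact: (good_two_zeros p n a b c d).
- by apply: (good_one_zero p n a b d c) => //; lia.
- exact: (good_one_zero p n a b c d).
- exact: (good_ndvd p n a b c d).
Qed.

(** * The prime 5 *)

Definition dvdv (q : Z) (v : vec) : Prop := forall i, Z.divide q (co v i).

Lemma dvdv_sym q f v : sym f -> dvdv q (f v) -> dvdv q v.
Proof.
have H4 w : dvdv q w <-> [/\ Z.divide q (co w 0), Z.divide q (co w 1),
    Z.divide q (co w 2) & Z.divide q (co w 3)].
  by split=> [H|[H0 H1 H2 H3] [|[|[|i]]]] //; case: w {H0 H1 H2} H3.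
elim=> {f} // f _ IH /H4 H; apply/IH/H4; move: H; case: (f v) => a b c d /= [] //.
by move=> /Z.divide_opp_r.
Qed.

(** The reflection negates u . v, so q divides 3k, hence k, and the correction term is divisible by
    q. Non-divisibility by q thus survives moves. *)
Lemma dvdv_move3 q u v : rel_prime q 3 -> In u units -> Z.divide 3 (dot u v) ->
  dvdv q (move3 u v) -> dvdv q v.
Proof.
move=> q3 Hu [k Ek]; rewrite /move3 Ek Z.div_mul // => H.
have [t Et] : Z.divide q k.
  apply: (Gauss _ 3) => //; rewrite Z.mul_comm -Ek.
  have -> : dot u v = - dot u (lin v (- 2 * k) u).
    transitivity (- (dot u v - 2 * k * dot u u)); first by rewrite (dot_unit _ Hu) Ek; ring.
    by rewrite /dot !co_lin; ring.
  by apply/Z.divide_opp_r; rewrite /dot; do !apply: Z.divide_add_r; apply: Z.divide_mul_r.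
move=> i; case: (H i) => s; rewrite co_lin => Es.
by exists (s + 2 * t * co u i); rewrite Et in Es; lia.
Qed.

Lemma trapped_rep n (Q : vec -> Prop) : n mod 3 = 1 -> ~ Z.divide 5 n -> ~ good 5 n ->
  (forall f, sym f -> forall v, Q v -> Q (f v)) ->
  (forall u v, In u units -> Z.divide 3 (dot u v) -> Q v -> Q (move3 u v)) ->
  trapped (fun v => dot v v = n /\ Q v).
Proof.
move=> n1 n5 bad Qs Qm; split.
- by move=> f Sf v [E Qv]; rewrite dot_sym //; split => //; apply: Qs.
- by move=> u v Hu D [E Qv]; rewrite dot_move3 //; split => //; apply: Qm.
- by move=> v [-> _].
- by move=> v [-> _].
- move=> v [E _]; apply: NNPP => none; apply: bad.
  have nz i : zero_or_ndvd 5 (co v i) by right => D; apply: none; exists i.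
  by exists (co v 0), (co v 1), (co v 2), (co v 3); rewrite -E.
Qed.

Lemma good_scale p n c : Znumtheory.prime p -> ~ Z.divide p c -> good p n -> good p (c * c * n).
Proof.
move=> pr Hc [x [y [z [w [<- [Hx Hy Hz Hw]]]]]].
have H t : zero_or_ndvd p t -> zero_or_ndvd p (c * t).
  by case=> [->|Ht]; [left; ring | right; apply: ndvd_mul].
by exists (c * x), (c * y), (c * z), (c * w); split; [ring | split; apply: H].
Qed.

Lemma prime5 : Znumtheory.prime 5.
Proof. exact: (prime_Z 5). Qed.

Lemma good5_intro n a b c d : a * a + b * b + c * c + d * d = n ->
  everyb (fun x => if x =? 0 then true else negb (x mod 5 =? 0)) (a :: b :: c :: d :: nil) ->
  good 5 n.
Proof.
move=> E H; exists a, b, c, d; split => //.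
have K x : In x (a :: b :: c :: d :: nil) -> zero_or_ndvd 5 x.
  by move=> /(everybP _ _ _ H); case: Z.eqb_spec; [left | move=> _ /not_dvd5E; right].
by split; apply: K => /=; tauto.
Qed.

(** The lines have norms 1, 46, 94 and 79; the first three have good representations, which scale to
    n. *)
Lemma bad5_79 n (Q : vec -> Prop) v : n mod 3 = 1 -> ~ Z.divide 5 n -> ~ good 5 n ->
  (forall f, sym f -> forall v, Q v -> Q (f v)) ->
  (forall u v, In u units -> Z.divide 3 (dot u v) -> Q v -> Q (move3 u v)) ->
  dot v v = n -> Q v ->
  exists w r c, [/\ Q w, forall i, co w i = c * co r i & n = c * c * 79].
Proof.
move=> n1 n5 bad Qs Qm Ev Qv.
have T := trapped_rep n Q n1 n5 bad Qs Qm.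
have [w [r [c [[Ew Qw] Hr E]]]] := trapped_line _ v T (conj Ev Qv).
have En : n = c * c * dot r r by rewrite -Ew /dot !E; ring.
have c5 : ~ Z.divide 5 c.
  by move=> D; apply: n5; rewrite En; apply: Z.divide_mul_l; apply: Z.divide_mul_l.
have G m a b x y : dot r r = m -> a * a + b * b + x * x + y * y = m ->
    everyb (fun x => if x =? 0 then true else negb (x mod 5 =? 0)) (a :: b :: x :: y :: nil) ->
    False.
  move=> Er Em Hm; apply: bad; rewrite En Er.
  by apply: good_scale c5 _; [exact: prime5 | apply: good5_intro Em Hm].
exists w, r, c; split => //; rewrite En; congr (_ * _).
move: Hr => /= H; decompose [or] H => //; subst r => //; exfalso.
- exact: (G 1 1 0 0 0).
- exact: (G 46 1 0 3 6).
- exact: (G 46 1 0 3 6).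
- exact: (G 94 7 0 3 6).
- exact: (G 94 7 0 3 6).
- exact: (G 94 7 0 3 6).
- exact: (G 94 7 0 3 6).
Qed.

(* The vector is q v0 - 2 (v0 . x) x with v0 = (2, 5, 5, 5) and x . x = q: q times the
   reflection of v0 in x. *)
Lemma primitive_79 q x0 : Znumtheory.prime q -> 5 < q -> dot x0 x0 = q ->
  exists v, dot v v = 79 * (q * q) /\ ~ dvdv q v.
Proof.
move=> qp q5 Ex0; set v0 := V 2 5 5 5.
have nsmall t : 0 < Z.abs t < q -> ~ Z.divide q t by apply: ndvd_small.
(* Not all coordinates of [x0] are divisible by q, as q squared does not divide q; a rotation brings
   a suitable one to the front. *)
have [x [Ex Dx]] : exists x, dot x x = q /\ ~ Z.divide q (co x 0).
  have nd : ~ dvdv q x0.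
    move=> H; case: (H 0%nat) (H 1%nat) (H 2%nat) (H 3%nat) => [a Ea] [b Eb] [c Ec] [d Ed].
    move: Ex0; rewrite /dot Ea Eb Ec Ed => E.
    have : Z.divide q 1.
      exists (a * a + b * b + c * c + d * d).
      by apply: (Z.mul_reg_l _ _ q); [lia | rewrite Z.mul_1_r -[LHS]E; ring].
    exact: (nsmall 1 ltac:(lia)).
  have R f : sym f -> dot (f x0) (f x0) = q by move=> Sf; rewrite dot_sym.
  have S1 := sym_rot4 _ sym_id; have S2 := sym_rot4 _ S1; have S3 := sym_rot4 _ S2.
  apply: NNPP => none; apply: nd => i.
  apply: NNPP => Hi; apply: none.
  case: x0 Ex0 R Hi => a b c d Ex0 R; case: i => [|[|[|i]]] Hi.
  - by exists (V a b c d).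
  - by exists (rot4 (V a b c d)); split => //; apply: (R _ S1).
  - by exists (rot4 (rot4 (V a b c d))); split => //; apply: (R _ S2).
  - by exists (rot4 (rot4 (rot4 (V a b c d)))); split => //; apply: (R _ S3).
have key y : dot y y = q -> ~ Z.divide q (co y 0) -> ~ Z.divide q (dot v0 y) ->
    exists v, dot v v = 79 * (q * q) /\ ~ dvdv q v.
  move=> Ey Dy Hd; exists (lin (lin (V 0 0 0 0) q v0) (- 2 * dot v0 y) y); split.
    transitivity (q * q * dot v0 v0 - 4 * q * dot v0 y * dot v0 y
        + 4 * dot v0 y * dot v0 y * dot y y); last by rewrite Ey (_ : dot v0 v0 = 79) //; ring.
    by rewrite {2 3 4 5}/dot /dot !co_lin; cbn [co]; ring.
  move=> /(_ 0%nat); rewrite !co_lin; cbn [co] => -[t Et].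
  case: (ndvd_mul q (2 * dot v0 y) (co y 0) qp) => //.
    by apply: ndvd_mul => //; apply: nsmall; lia.
  by exists (2 - t); move: Et; rewrite /v0; cbn [co]; lia.
case: (classic (Z.divide q (dot v0 x))) => H; last exact: (key x).
(* Changing the sign of the first coordinate a changes v0 . x by 4a, which is prime to q. *)
apply: (key (neg1 x)); first by rewrite (dot_sym _ (sym_neg1 _ sym_id)).
  by case: x Dx {Ex H} => a b c d /= Dx /Z.divide_opp_r.
case: x Ex Dx H => a b c d Ex; rewrite /dot; cbn [co neg1 v0] => Da [s Es] [t Et].
case: (ndvd_mul q 4 a qp) => //; first by apply: nsmall; lia.
by exists (s - t); lia.
Qed.

(** Vectors not divisible by q would form a trapped set, nonempty by [primitive_79]; but a vector c
    r in it with norm 79 c^2 has q dividing c. *)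
Lemma good5_79q q : Znumtheory.prime q -> 5 < q -> (exists x, dot x x = q) ->
  good 5 (q * q * 79).
Proof.
move=> qp q5 [x Ex]; apply: NNPP => bad.
have [v [Ev Qv]] := primitive_79 q x qp q5 Ex.
have q3 : rel_prime q 3.
  by apply: prime_rel_prime => // D; have := Z.divide_pos_le _ _ _ D; lia.
have ndvd t : 1 < t < q -> ~ Z.divide t q by apply: (proj2 (proj2 (prime_alt q) qp)).
have n1 : (q * q * 79) mod 3 = 1.
  case: (sqr_mod3 q) => [[q0 _]|[_ [s Es]]]; last by rewrite Es; mlia.
  by case: (ndvd 3); [lia | apply/Z.mod_divide].
have n5 : ~ Z.divide 5 (q * q * 79).
  have q5n : ~ Z.divide 5 q by apply: ndvd; lia.
  apply: (ndvd_mul 5 (q * q) 79 prime5); first exact: (ndvd_mul 5 q q prime5).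
  exact/(not_dvd5E 79).
have [|||w [r [c [Qw E En]]]] := bad5_79 _ (fun v => ~ dvdv q v) v n1 n5 bad _ _ _ Qv.
- by move=> f Sf u Qu /(dvdv_sym _ _ _ Sf).
- by move=> u y Hu D Qu /(dvdv_move3 _ _ _ q3 Hu D).
- by rewrite Ev; ring.
apply: Qw => i; rewrite E; apply: Z.divide_mul_l.
have : Z.divide q (c * c) by exists q; lia.
by case/(prime_mult _ qp).
Qed.

Lemma good5 (n : nat) : (0 < n)%N -> Z.of_nat n mod 3 = 1 -> ~ Z.divide 5 (Z.of_nat n) ->
  n <> 79%N -> good 5 (Z.of_nat n).
Proof.
move=> n0 n1 n5 n79; apply: NNPP => bad.
have [v Ev] := four_squares n.
have [||w [r [c [_ _ En]]]] := bad5_79 _ (fun _ => True) v n1 n5 bad _ _ Ev I; [by []|by []|].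
have Ec : c * c = Z.of_nat (Z.abs_nat c) * Z.of_nat (Z.abs_nat c).
  by rewrite Zabs2Nat.id_abs; lia.
move: En; rewrite Ec; move: (Z.abs_nat c) => m {c Ec} En.
have m5 : ~ Z.divide 5 (Z.of_nat m).
  by move=> D; apply: n5; rewrite En; apply: Z.divide_mul_l; apply: Z.divide_mul_l.
case: (ltngtP m 1) => [|m1|m1].
- by case: m En {m5} => // En _; move/ltP: n0; lia.
- have pr := pdiv_prime m1; have /dvdnP [t Et] := pdiv_dvd m.
  move: (pdiv m) pr Et => q pr Et.
  have Ez : Z.of_nat m = Z.of_nat t * Z.of_nat q by rewrite Et -multE Nat2Z.inj_mul.
  have t5 : ~ Z.divide 5 (Z.of_nat t).
    by move=> D; apply: m5; rewrite Ez; apply: Z.divide_mul_l.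
  apply: bad.
  have -> : Z.of_nat n = Z.of_nat t * Z.of_nat t * (Z.of_nat q * Z.of_nat q * 79).
    by rewrite En Ez; ring.
  apply: good_scale t5 _; first exact: prime5.
  have qz := prime_Z q pr; have q2 := prime_ge_2 _ qz.
  (* [good5_79q] needs q > 5: for q = 2, 316 = 13^2 + 7^2 + 7^2 + 7^2, while 3 and 5 would divide
     n. *)
  case: (Z.eq_dec (Z.of_nat q) 2) => [->|q2']; first exact: (good5_intro _ 13 7 7 7).
  have q3 : Z.of_nat q <> 3.
    move=> q3; move: n1; rewrite En Ez q3.
    have -> : Z.of_nat t * 3 * (Z.of_nat t * 3) * 79 = Z.of_nat t * Z.of_nat t * 237 * 3 by ring.
    by rewrite Z.mod_mul.
  have q5 : Z.of_nat q <> 5.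
    by move=> q5; apply: m5; exists (Z.of_nat t); rewrite Ez q5.
  have q4 : Z.of_nat q <> 4.
    move=> q4; case: (proj2 (prime_alt _) qz) => _ /(_ 2); rewrite q4; apply; first lia.
    by exists 2.
  by apply: good5_79q => //; [lia | apply: four_squares].
by apply: n79; rewrite m1 in En; lia.
Qed.

(** * Sequences of natural numbers and the exceptional case *)

Lemma good_nat (p n : nat) : good (Z.of_nat p) (Z.of_nat n) -> exists s : seq nat,
  [/\ (size s <= 4)%N, all (fun x => ~~ (p %| x)) s & \sum_(x <- s) x ^ 2 = n].
Proof.
move=> [a [b [c [d [E [Ha Hb Hc Hd]]]]]].
have K x : zero_or_ndvd (Z.of_nat p) x -> exists s : seq nat,
    [/\ (size s <= 1)%N, all (fun x => ~~ (p %| x)) s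
      & Z.of_nat (\sum_(x <- s) x ^ 2) = x * x].
  case=> [->|Hx]; first by exists [::]; rewrite big_nil.
  exists [:: Z.abs_nat x]; split => //=.
    rewrite andbT; apply/negP => /dvdnP [k Ek]; apply: Hx.
    apply/Z.divide_abs_r; exists (Z.of_nat k).
    by rewrite -Nat2Z.inj_mul multE -Ek Zabs2Nat.id_abs.
  by rewrite big_seq1 -mulnn -multE Nat2Z.inj_mul Zabs2Nat.id_abs; lia.
have [sa [la aa Ea]] := K a Ha; have [sb [lb ab Eb]] := K b Hb.
have [sc [lc ac Ec]] := K c Hc; have [sd [ld ad Ed]] := K d Hd.
exists (sa ++ sb ++ sc ++ sd); split.
- by rewrite !size_cat (leq_add la) // (leq_add lb) // (leq_add lc).
- by rewrite !all_cat aa ab ac ad.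
- by rewrite !big_cat /=; apply: Nat2Z.inj; rewrite -!plusE !Nat2Z.inj_add Ea Eb Ec Ed -E; ring.
Qed.

Lemma mod3_Z (n : nat) : n = 1 %[mod 3] -> Z.of_nat n mod 3 = 1.
Proof.
move=> n3; rewrite (divn_eq n 3) n3 -plusE -multE Nat2Z.inj_add Nat2Z.inj_mul.
by rewrite Z.add_comm Z.mod_add.
Qed.

Lemma ndvd_Z (p n : nat) : (0 < p)%N -> ~~ (p %| n) -> ~ Z.divide (Z.of_nat p) (Z.of_nat n).
Proof.
move=> /ltP p0 /negP H [q Eq]; apply: H; apply/dvdnP; exists (Z.to_nat q).
by apply: Nat2Z.inj; rewrite -multE Nat2Z.inj_mul Z2Nat.id //; nia.
Qed.

End IntegerVectors.

Lemma sum_of_squares_seq (p n : nat) (s : seq nat) : prime p ->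
  all (fun x => ~~ (p %| x)) s -> \sum_(x <- s) x ^ 2 = n ->
  sum_of_squares_not_divisible p (size s) (Posz n).
Proof.
move=> pr Hs En; exists (fun i => Posz (nth 0%N s i)); split.
  rewrite -En (big_nth 0%N) big_mkord (big_morph Posz PoszD (erefl _)).
  by apply: eq_bigr => i _; rewrite -mulnn PoszM GRing.expr2.
rewrite -(big_morph Posz PoszM (erefl _)) /gcdz /=.
suff /eqP -> : coprime p (\prod_(i < size s) nth 0%N s i) by [].
rewrite prime_coprime // Euclid_dvd_prod // big_has.
apply/hasPn => i _; move/allP: Hs; apply; exact: mem_nth.
Qed.

Lemma sum_of_squares_to_seq (p k n : nat) : prime p ->
  sum_of_squares_not_divisible p k (Posz n) -> exists s : seq nat,
  [/\ size s = k, all (fun x => ~~ (p %| x)) s & \sum_(x <- s) x ^ 2 = n].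
Proof.
move=> pr [x [En Hx]]; exists [seq absz (x i) | i <- enum 'I_k]; split.
- by rewrite size_map size_enum_ord.
- apply/allP => _ /mapP [i _ ->]; move/eqP: Hx.
  rewrite /gcdz /= eqz_nat -/(coprime _ _) prime_coprime //; apply: contra.
  by move=> D; rewrite (bigD1 i) //= abszM dvdn_mulr.
- apply/eqP; rewrite -eqz_nat En big_map big_enum /= (big_morph Posz PoszD (erefl _)).
  apply/eqP/eq_bigr => i _; rewrite -mulnn PoszM -GRing.expr2 abszE -Num.Theory.normrX.
  by rewrite Num.Theory.ger0_norm ?Num.Theory.sqr_ge0.
Qed.

(** Exhaustive search for at most k squares prime to 5; roots below 9 suffice because 9^2 exceeds
    79. *)
Fixpoint squares5 (k m : nat) : bool :=
  if m == 0 then true else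
  if k is k'.+1 then
    has (fun x => [&& ~~ (5 %| x), x ^ 2 <= m & squares5 k' (m - x ^ 2)]) (iota 0 9)
  else false.

Lemma squares5P k s : size s <= k -> all (fun x => ~~ (5 %| x)) s ->
  \sum_(x <- s) x ^ 2 <= 79 -> squares5 k (\sum_(x <- s) x ^ 2).
Proof.
have S k' m : squares5 k'.+1 m = (m == 0) ||
    has (fun x => [&& ~~ (5 %| x), x ^ 2 <= m & squares5 k' (m - x ^ 2)]) (iota 0 9).
  by rewrite -[LHS]/(if m == 0 then true else _); case: (m == 0).
elim: k s => [|k IH] [|x s]; rewrite ?big_nil // big_cons S ltnS.
move=> ks /andP [x5 Hs] le79; apply/orP; right; apply/hasP; exists x.
  rewrite mem_iota /= add0n -(@ltn_exp2r _ _ 2) //.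
  by apply: (leq_ltn_trans (leq_trans (leq_addr _ _) le79)).
by rewrite x5 leq_addr addKn IH //; apply: leq_trans le79; exact: leq_addl.
Qed.

Theorem theorem4p3 (p n : nat) (p_prime : prime p) (p_gt3 : 3 < p)
    (n_gt0 : 0 < n) (p_ndvd_n : ~~ (p %| n)) (n_mod3 : n = 1 %[mod 3]) :
  (exists k : nat, 0 < k <= 4 /\ sum_of_squares_not_divisible p k (Posz n))
    <-> ~ (p = 5 /\ n = 79).
Proof.
split=> [[k [/andP [_ k4] Hk]] [Ep En]|H].
  have [s [Es Hs Sn]] := sum_of_squares_to_seq _ _ _ p_prime Hk; subst p n.
  have : squares5 4 79 by rewrite -[79]Sn; apply: squares5P; rewrite ?Es ?Sn.
  by vm_compute.
have pz := prime_Z p p_prime.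
have n1 := mod3_Z n n_mod3.
have pn := ndvd_Z p n (ltnW (ltnW (ltnW p_gt3))) p_ndvd_n.
have gd : good (Z.of_nat p) (Z.of_nat n).
  case: (eqVneq p 5) => [E5|p5].
    by subst p; apply: good5 => // E79; apply: H.
  apply: good_large => //; last exact: four_squares.
  have : 5 < p.
    by case: (ltngtP p 5) p5 => //; case: p p_gt3 p_prime {H pz pn p_ndvd_n} => [|[|[|[|[|]]]]].
  by move/ltP; lia.
have [s [s4 Hs Es]] := good_nat _ _ gd.
exists (size s); split; last exact: sum_of_squares_seq Hs Es.
rewrite s4 andbT; case: s Es {s4 Hs} => //; rewrite big_nil => E.
by rewrite -E in n_gt0.
Qed.
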